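(* The norm of the Hilbert matrix operator $\mathcal{H}$ acting from $H^\infty$ into the Bloch space $\mathcal{B}$ satisfies $$\|\mathcal{H}\|_{H^\infty\rightarrow\mathcal{B}}=3.$$
   Context: $\mathbb{D}$ is the open unit disk in $\mathbb{C}$ and $H(\mathbb{D})$ is the set of analytic functions on $\mathbb{D}$. $H^\infty$ is the space of all $f\in H(\mathbb{D})$ with $\|f\|_{H^\infty}=\sup_{z\in\mathbb{D}}|f(z)|<\infty$. The classical Bloch space $\mathcal{B}$ consists of those $f\in H(\mathbb{D})$ with $$\|f\|_{\mathcal{B}}=|f(0)|+\sup_{z\in\mathbb{D}}(1-|z|^2)|f'(z)|<\infty.$$ The Hilbert matrix operator $\mathcal{H}$ acts on $f(z)=\sum_{k\ge 0}a_kz^k\in H(\mathbb{D})$ by $$\mathcal{H}f(z)=\sum_{n=0}^\infty\left(\sum_{k=0}^\infty\frac{a_k}{n+k+1}\right)z^n,$$ whenever the right-hand side makes sense and defines an analytic function in $\mathbb{D}$. For normed spaces $X,Y$ of analytic functions, $\|\mathcal{H}\|_{X\to Y}=\sup\{\|\mathcal{H}f\|_Y:\ f\in X,\ \|f\|_X\le 1\}$. *)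

(* Defs.v *)
From Stdlib Require Import Reals.
From Coquelicot Require Import Coquelicot.
Open Scope R_scope.

(** A function on the unit disk is represented by a total function [C -> C];
    its values outside the disk play no role in any definition below. *)

Definition in_disk (z : C) : Prop := Cmod z < 1.

Definition analytic_on_disk (f : C -> C) : Prop :=
  forall z0 : C, in_disk z0 ->
  exists (r : R) (c : nat -> C),
    0 < r /\
    forall z : C, Cmod (z - z0)%C < r -> is_pseries c (z - z0)%C (f z).

Definition sup_on_disk (u : C -> R) : Rbar :=
  Lub_Rbar (fun r : R => exists z : C, in_disk z /\ r = u z).

Definition Hinfty_norm (f : C -> C) : Rbar :=
  sup_on_disk (fun z => Cmod (f z)).

Definition in_Hinfty (f : C -> C) : Prop :=
  analytic_on_disk f /\ is_finite (Hinfty_norm f).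

Definition Bloch_norm (f : C -> C) : Rbar :=
  Rbar_plus (Finite (Cmod (f (RtoC 0))))
    (sup_on_disk (fun z => (1 - Cmod z ^ 2) * Cmod (C_derive f z))).

Definition in_Bloch (f : C -> C) : Prop :=
  analytic_on_disk f /\ is_finite (Bloch_norm f).

(** The graph of the Hilbert matrix operator: [a] is the sequence of Taylor
    coefficients of [f] at the origin, and [f] is in the domain exactly when
    all the series for the [b n] converge and the power series with
    coefficients [b n] converges on the whole disk. *)
Definition hilbert_image (f g : C -> C) : Prop :=
  exists a b : nat -> C,
    (forall z : C, in_disk z -> is_pseries a z (f z)) /\
    (forall n : nat,
       is_series (fun k : nat => (a k / RtoC (INR (n + k + 1)))%C) (b n)) /\
    (forall z : C, in_disk z -> is_pseries b z (g z)).

(** The operator [T] is given by its graph, the supremum being taken in the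
    extended reals. An [f] at which [T] is undefined contributes nothing, so
    this is the norm of [T] only if [T] is defined on all of [X]. *)
Definition operator_norm (X : (C -> C) -> Prop) (normX normY : (C -> C) -> Rbar)
    (T : (C -> C) -> (C -> C) -> Prop) : Rbar :=
  Rbar_lub (fun r : Rbar =>
    exists f g : C -> C,
      X f /\ Rbar_le (normX f) (Finite 1) /\ T f g /\ r = normY g).

(* Main.v *)
(** For [|f| <= M] on the disk, the n-th Taylor coefficient of [H f] is the integral
    of [t^n f(t)] over [[0,1]], hence is at most [M/(n+1)]. So [|H f (0)| <= M] and
    [|(H f)'(z)| <= M (1 + |z| + |z|^2 + ...) = M/(1-|z|)], which gives the upper bound
    [M + sup (1+|z|) M <= 3 M]. It is attained by [f = 1]: there
    [(H f)'(r) = sum (j+1)/(j+2) r^j], and [(1-r^2) (H f)'(r)] tends to [2] as [r -> 1].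

    That the Taylor series at [0] of a bounded [f] converges to [f] on the whole disk is
    obtained without contour integrals: Bessel's inequality (averaging over roots of
    unity) gives Cauchy estimates, and these, applied to all derivatives of [f] on a disk
    [D(0,rho)] over which the local expansions have radius at least [delta], show that the
    series at [0] converges on [D(0,rho+delta)]. The square summability of the
    coefficients also makes the series defining [H f] absolutely convergent. *)

(* Analyticity is given by local power series of unknown radius, while the operator reads the
   coefficients at [0], which a priori describe [f] only near [0]. Continuation by a fixed step
   needs a common [delta]; compactness provides one on each closed disk of radius below [1].
   Coefficients must then be bounded on a disk larger than the one where the expansion is known:
   bounds on all derivatives over [D(0,rho)] replace an integral over the larger circle, at the
   price of a factor [k + 1] that is harmless for the radius of convergence.

   The moment bound for [b n] also avoids integrating complex functions: after rotation by a
   unimodular constant it concerns a real power series on [[0,1)], estimated through its derivative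
   and carried to the endpoint by Abel's theorem.

   For [f = 1], the defect of [(j+1)/(j+2)] from [1] contributes only a logarithm of [1/(1-r)]. The
   AM-GM inequality bounds it by [(e/2)/(1-r) + 1/e], and [e = sqrt (1-r)] makes this negligible
   against [1/(1-r)]. *)
Require Import Defs.
From Stdlib Require Import Reals Lra Lia Classical ClassicalEpsilon.
From Coquelicot Require Import Coquelicot.

(** * Finite sums and series of complex numbers *)

(** [Csum u n] and [Rsum u n] have [n] terms, Coquelicot's [sum_n u n] has [n + 1]. *)
Fixpoint Csum (u : nat -> C) (n : nat) : C :=
  match n with
  | O => RtoC 0
  | S m => (Csum u m + u m)%C
  end.

Fixpoint Rsum (u : nat -> R) (n : nat) : R :=
  match n with
  | O => 0
  | S m => Rsum u m + u m
  end.

Lemma Csum_ext (u v : nat -> C) (n : nat) :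
  (forall k, (k < n)%nat -> u k = v k) -> Csum u n = Csum v n.
Proof.
  induction n as [|n IH]; intros H; simpl; [reflexivity|].
  rewrite IH by (intros; apply H; lia). rewrite H by lia. reflexivity.
Qed.

Lemma Csum_plus (u v : nat -> C) (n : nat) :
  Csum (fun k => u k + v k)%C n = (Csum u n + Csum v n)%C.
Proof. induction n as [|n IH]; simpl; [|rewrite IH]; ring. Qed.

Lemma Csum_mult_l (c : C) (u : nat -> C) (n : nat) :
  Csum (fun k => c * u k)%C n = (c * Csum u n)%C.
Proof. induction n as [|n IH]; simpl; [|rewrite IH]; ring. Qed.

Lemma Csum_switch (u : nat -> nat -> C) (m n : nat) :
  Csum (fun i => Csum (u i) n) m = Csum (fun j => Csum (fun i => u i j) m) n.
Proof.
  induction m as [|m IH]; simpl.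
  - induction n as [|n IHn]; simpl; [reflexivity|]. rewrite <- IHn. ring.
  - rewrite IH, <- Csum_plus. reflexivity.
Qed.

Lemma Csum_const (c : C) (n : nat) : Csum (fun _ => c) n = (RtoC (INR n) * c)%C.
Proof.
  induction n as [|n IH]; [simpl; ring|]. rewrite S_INR, RtoC_plus.
  change (Csum (fun _ => c) n + c = (INR n + 1) * c)%C. rewrite IH. ring.
Qed.

Lemma Csum_single (u : nat -> C) (n k : nat) :
  (k < n)%nat -> (forall i, (i < n)%nat -> i <> k -> u i = RtoC 0) ->
  Csum u n = u k.
Proof.
  induction n as [|n IH]; intros Hk H; [lia|]. simpl.
  destruct (Nat.eq_dec k n) as [->|Hne].
  - rewrite (Csum_ext u (fun _ => RtoC 0)) by (intros; apply H; lia).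
    rewrite Csum_const. ring.
  - rewrite IH by (try lia; intros; apply H; lia). rewrite (H n) by lia. ring.
Qed.

Lemma Csum_split_first (u : nat -> C) (n : nat) :
  Csum u (S n) = (u O + Csum (fun k => u (S k)) n)%C.
Proof.
  induction n as [|n IH]; [simpl; ring|].
  change (Csum u (S n) + u (S n) =
          u O + (Csum (fun k => u (S k)) n + u (S n)))%C.
  rewrite IH. ring.
Qed.

Lemma Csum_conj (u : nat -> C) (n : nat) :
  Cconj (Csum u n) = Csum (fun k => Cconj (u k)) n.
Proof.
  induction n as [|n IH]; simpl.
  - unfold Cconj, RtoC; simpl. f_equal; ring.
  - rewrite Cplus_conj, IH. reflexivity.
Qed.

Lemma Csum_RtoC (u : nat -> R) (n : nat) :
  Csum (fun k => RtoC (u k)) n = RtoC (Rsum u n).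
Proof.
  induction n as [|n IH]; simpl; [reflexivity|]. rewrite IH, RtoC_plus. reflexivity.
Qed.

Lemma Cmod_Csum_le (u : nat -> C) (n : nat) :
  Cmod (Csum u n) <= Rsum (fun k => Cmod (u k)) n.
Proof.
  induction n as [|n IH]; simpl; [rewrite Cmod_0; lra|].
  eapply Rle_trans; [apply Cmod_triangle|]. lra.
Qed.

Lemma Rsum_ext (u v : nat -> R) (n : nat) :
  (forall k, (k < n)%nat -> u k = v k) -> Rsum u n = Rsum v n.
Proof.
  induction n as [|n IH]; intros H; simpl; [reflexivity|].
  rewrite IH by (intros; apply H; lia). rewrite H by lia. reflexivity.
Qed.

Lemma Rsum_le (u v : nat -> R) (n : nat) :
  (forall k, (k < n)%nat -> u k <= v k) -> Rsum u n <= Rsum v n.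
Proof.
  induction n as [|n IH]; intros H; simpl; [lra|].
  apply Rplus_le_compat; [apply IH; intros; apply H; lia | apply H; lia].
Qed.

Lemma Rsum_const (c : R) (n : nat) : Rsum (fun _ => c) n = INR n * c.
Proof. induction n as [|n IH]; [simpl; ring|]. rewrite S_INR; simpl; rewrite IH; ring. Qed.

Lemma Rsum_mult_l (c : R) (u : nat -> R) (n : nat) :
  Rsum (fun k => c * u k) n = c * Rsum u n.
Proof. induction n as [|n IH]; simpl; [|rewrite IH]; ring. Qed.

Lemma Rsum_incr (u : nat -> R) (m n : nat) :
  (forall k, 0 <= u k) -> (m <= n)%nat -> Rsum u m <= Rsum u n.
Proof.
  intros H Hmn. induction Hmn as [|n Hmn IH]; [lra|]. simpl. specialize (H n). lra.
Qed.

Lemma Rsum_nonneg (u : nat -> R) (n : nat) : (forall k, 0 <= u k) -> 0 <= Rsum u n.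
Proof. intros H. apply (Rsum_incr u 0 n H). lia. Qed.

Lemma sum_n_Rsum (u : nat -> R) (n : nat) : sum_n u n = Rsum u (S n).
Proof.
  induction n as [|n IH].
  - rewrite sum_O. simpl. ring.
  - rewrite sum_Sn, IH. reflexivity.
Qed.

Lemma sum_n_Csum (u : nat -> C) (n : nat) :
  @sum_n C_AbelianMonoid u n = Csum u (S n).
Proof.
  induction n as [|n IH].
  - rewrite sum_O. simpl. ring.
  - rewrite sum_Sn, IH. reflexivity.
Qed.

(** * Convergence of real and complex series *)

Lemma ex_series_Rsum_bounded (u : nat -> R) (B : R) :
  (forall k, 0 <= u k) -> (forall n, Rsum u n <= B) -> ex_series u.
Proof.
  intros Hu HB.
  destruct (ex_finite_lim_seq_incr (sum_n u) B) as [l Hl].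
  - intros n. rewrite sum_Sn. specialize (Hu (S n)). unfold plus; simpl. lra.
  - intros n. rewrite sum_n_Rsum. apply HB.
  - exists l. exact Hl.
Qed.

Lemma is_lim_seq_Rsum (u : nat -> R) :
  ex_series u -> is_lim_seq (Rsum u) (Series u).
Proof.
  intros H. apply is_lim_seq_incr_1.
  apply is_lim_seq_ext with (sum_n u); [intros; apply sum_n_Rsum|].
  exact (Series_correct _ H).
Qed.

Lemma Rsum_le_Series (u : nat -> R) (n : nat) :
  (forall k, 0 <= u k) -> ex_series u -> Rsum u n <= Series u.
Proof.
  intros Hu H. apply (is_lim_seq_incr_compare (Rsum u)).
  - apply is_lim_seq_Rsum, H.
  - intros k. simpl. specialize (Hu k). lra.
Qed.

(** Convergence is phrased as a real sequence tending to [0], so that squeeze and comparison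
    arguments for real limits apply; [is_series_Cseries] links it to the filter-based notion. *)
Definition Cseries (u : nat -> C) (l : C) : Prop :=
  is_lim_seq (fun n => Cmod (Csum u n - l)) 0.

Lemma is_series_Cseries (u : nat -> C) (l : C) :
  @is_series C_AbsRing C_NormedModule u l <-> Cseries u l.
Proof.
  unfold Cseries. split; intros H.
  - apply is_lim_seq_incr_1. apply is_lim_seq_spec. intros eps.
    destruct (proj1 (filterlim_locally_ball_norm _ _) H eps) as [N HN].
    exists N. intros n Hn. specialize (HN n Hn). unfold ball_norm in HN.
    rewrite sum_n_Csum in HN. rewrite Rminus_0_r, Rabs_pos_eq by apply Cmod_ge_0.
    exact HN.
  - apply (proj2 (filterlim_locally_ball_norm _ _)). intros eps.
    apply is_lim_seq_incr_1 in H. apply is_lim_seq_spec in H.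
    destruct (H eps) as [N HN]. exists N. intros n Hn. specialize (HN n Hn).
    rewrite Rminus_0_r, Rabs_pos_eq in HN by apply Cmod_ge_0.
    unfold ball_norm. rewrite sum_n_Csum. exact HN.
Qed.

Lemma Cmod_minus_sym (x y : C) : Cmod (x - y) = Cmod (y - x).
Proof. rewrite <- Cmod_opp. f_equal. ring. Qed.

Lemma Cseries_intro (u : nat -> C) (l : C) (e : nat -> R) :
  (forall n, Cmod (Csum u n - l) <= e n) -> is_lim_seq e 0 -> Cseries u l.
Proof.
  intros H He. unfold Cseries.
  apply is_lim_seq_le_le with (fun _ => 0) e.
  - intros n. split; [apply Cmod_ge_0 | apply H].
  - apply is_lim_seq_const.
  - exact He.
Qed.

Lemma Cseries_unique (u : nat -> C) (l1 l2 : C) :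
  Cseries u l1 -> Cseries u l2 -> l1 = l2.
Proof.
  intros H1 H2.
  assert (Hc : Cmod (l1 - l2) <= 0).
  { apply (is_lim_seq_le (fun _ => Cmod (l1 - l2))
      (fun n => Cmod (Csum u n - l1) + Cmod (Csum u n - l2)) (Cmod (l1 - l2)) 0).
    - intros n. rewrite (Cmod_minus_sym _ l1).
      replace (l1 - l2)%C with ((l1 - Csum u n) + (Csum u n - l2))%C by ring.
      apply Cmod_triangle.
    - apply is_lim_seq_const.
    - replace (Finite 0) with (Finite (0 + 0)) by (f_equal; ring).
      apply is_lim_seq_plus'; assumption. }
  assert (H0 : Cmod (l1 - l2) = 0) by (pose proof (Cmod_ge_0 (l1 - l2)); lra).
  apply Cmod_eq_0 in H0.
  replace l1 with ((l1 - l2) + l2)%C by ring. rewrite H0. ring.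
Qed.

Lemma Cseries_ext (u v : nat -> C) (l : C) :
  (forall n, u n = v n) -> Cseries u l -> Cseries v l.
Proof.
  intros H Hu. apply is_lim_seq_ext with (fun n => Cmod (Csum u n - l)); [|exact Hu].
  intros n. rewrite (Csum_ext u v) by auto. reflexivity.
Qed.

Lemma Cseries_plus (u v : nat -> C) (l m : C) :
  Cseries u l -> Cseries v m -> Cseries (fun n => u n + v n)%C (l + m)%C.
Proof.
  intros Hu Hv.
  apply Cseries_intro with (fun n => Cmod (Csum u n - l) + Cmod (Csum v n - m)).
  - intros n. rewrite Csum_plus.
    replace (Csum u n + Csum v n - (l + m))%C
      with ((Csum u n - l) + (Csum v n - m))%C by ring.
    apply Cmod_triangle.
  - replace (Finite 0) with (Finite (0 + 0)) by (f_equal; ring).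
    apply is_lim_seq_plus'; assumption.
Qed.

Lemma Cseries_mult_l (c : C) (u : nat -> C) (l : C) :
  Cseries u l -> Cseries (fun n => c * u n)%C (c * l)%C.
Proof.
  intros Hu. apply Cseries_intro with (fun n => Cmod c * Cmod (Csum u n - l)).
  - intros n. rewrite Csum_mult_l, <- Cmod_mult. right. f_equal. ring.
  - replace (Finite 0) with (Finite (Cmod c * 0)) by (f_equal; ring).
    apply is_lim_seq_scal_l with (lu := Finite 0). exact Hu.
Qed.

Lemma Cseries_minus (u v : nat -> C) (l m : C) :
  Cseries u l -> Cseries v m -> Cseries (fun n => u n - v n)%C (l - m)%C.
Proof.
  intros Hu Hv.
  replace (l - m)%C with (l + (- (1)) * m)%C by ring.
  apply Cseries_ext with (fun n => u n + (- (1)) * v n)%C; [intros; ring|].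
  apply Cseries_plus; [exact Hu | apply Cseries_mult_l, Hv].
Qed.

Lemma Cseries_Cmod_le (u : nat -> C) (l : C) (B : R) :
  Cseries u l -> (forall n, Cmod (Csum u n) <= B) -> Cmod l <= B.
Proof.
  intros Hu HB.
  apply (is_lim_seq_le (fun _ => Cmod l) (fun n => Cmod (Csum u n - l) + B) (Cmod l) B).
  - intros n. rewrite Cmod_minus_sym.
    replace l with ((l - Csum u n) + Csum u n)%C at 1 by ring.
    eapply Rle_trans; [apply Cmod_triangle|]. specialize (HB n). lra.
  - apply is_lim_seq_const.
  - replace (Finite B) with (Finite (0 + B)) by (f_equal; ring).
    apply is_lim_seq_plus'; [exact Hu | apply is_lim_seq_const].
Qed.

Lemma Cseries_abs (u : nat -> C) :
  ex_series (fun n => Cmod (u n)) -> exists l, Cseries u l.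
Proof.
  intros H.
  destruct (@ex_series_le C_AbsRing C_CompleteNormedModule u (fun n => Cmod (u n)))
    as [l Hl].
  - intros n. apply Rle_refl.
  - exact H.
  - exists l. apply is_series_Cseries, Hl.
Qed.

Lemma Cseries_incr (u : nat -> C) (l : C) :
  Cseries u l <-> Cseries (fun k => u (S k)) (l - u O)%C.
Proof.
  unfold Cseries. rewrite (is_lim_seq_incr_1 (fun n => Cmod (Csum u n - l))).
  split; apply is_lim_seq_ext; intros n; rewrite Csum_split_first; f_equal; ring.
Qed.

Lemma Cseries_shift (u : nat -> C) (m : nat) (l : C) :
  (forall k, (k < m)%nat -> u k = RtoC 0) ->
  Cseries (fun k => u (k + m)%nat) l -> Cseries u l.
Proof.
  revert u. induction m as [|m IH]; intros u H0 Hl.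
  - revert Hl. apply Cseries_ext. intros n. f_equal. lia.
  - apply Cseries_incr. rewrite (H0 O) by lia.
    replace (l - 0)%C with l by ring.
    apply IH.
    + intros k Hk. apply H0. lia.
    + revert Hl. apply Cseries_ext. intros n. f_equal. lia.
Qed.

Lemma Cseries_finite (u : nat -> C) (N : nat) :
  (forall k, (N <= k)%nat -> u k = RtoC 0) -> Cseries u (Csum u N).
Proof.
  intros H. apply (is_lim_seq_ext_loc (fun _ => 0)).
  - exists N. intros n Hn. induction Hn as [|n Hn IH].
    + replace (Csum u N - Csum u N)%C with (RtoC 0) by ring. rewrite Cmod_0. reflexivity.
    + simpl. rewrite (H n) by lia. rewrite Cplus_0_r. exact IH.
  - apply is_lim_seq_const.
Qed.

Lemma Csum_Cseries (u : nat -> nat -> C) (c : nat -> C) (M : nat) :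
  (forall m, Cseries (fun k => u k m) (c m)) ->
  Cseries (fun k => Csum (u k) M) (Csum c M).
Proof.
  intros H. induction M as [|M IH]; simpl.
  - apply (Cseries_finite (fun _ => RtoC 0) O). reflexivity.
  - apply Cseries_plus; [exact IH | apply H].
Qed.

(** Only the rows [k >= M] contribute to the error of the first [M] columns,
    so it is at most the tail of the majorant [V]. *)
Lemma Cseries_triangular_switch (u : nat -> nat -> C) (V : nat -> R)
    (c : nat -> C) (s : C) :
  (forall k m, (k < m)%nat -> u k m = RtoC 0) ->
  (forall k, Rsum (fun m => Cmod (u k m)) (S k) <= V k) ->
  ex_series V ->
  (forall m, Cseries (fun k => u k m) (c m)) ->
  Cseries (fun k => Csum (u k) (S k)) s ->
  Cseries c s.
Proof.
  intros Hu HV HVs Hc Hs.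
  assert (HV0 : forall k, 0 <= V k).
  { intros k. eapply Rle_trans; [|apply HV]. apply Rsum_nonneg. intros; apply Cmod_ge_0. }
  assert (Htri : forall k n, (S k <= n)%nat -> Csum (u k) n = Csum (u k) (S k)).
  { intros k n Hn. induction Hn as [|n Hn IH]; [reflexivity|].
    change (Csum (u k) n + u k n = Csum (u k) (S k))%C.
    rewrite IH, (Hu k n) by lia. ring. }
  assert (Htail : forall k M, (M <= S k)%nat ->
            Cmod (Csum (u k) M - Csum (u k) (S k)) <= V k).
  { intros k M HM. eapply Rle_trans; [|apply HV].
    assert (G : Cmod (Csum (u k) M - Csum (u k) (S k)) <=
                Rsum (fun m => Cmod (u k m)) (S k) - Rsum (fun m => Cmod (u k m)) M).
    { induction HM as [|n HM IH].
      - replace (Csum (u k) M - Csum (u k) M)%C with (RtoC 0) by ring.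
        rewrite Cmod_0. lra.
      - simpl.
        replace (Csum (u k) M - (Csum (u k) n + u k n))%C
          with ((Csum (u k) M - Csum (u k) n) + (- u k n))%C by ring.
        eapply Rle_trans; [apply Cmod_triangle|]. rewrite Cmod_opp. lra. }
    pose proof (Rsum_nonneg (fun m => Cmod (u k m)) M (fun m => Cmod_ge_0 _)). lra. }
  apply Cseries_intro with (fun M => Series V - Rsum V M).
  - intros M.
    apply Cseries_Cmod_le with (fun k => Csum (u k) M - Csum (u k) (S k))%C.
    + apply Cseries_minus; [|exact Hs]. apply Csum_Cseries, Hc.
    + intros K.
      (* Row [k] has no entries beyond column [k], so rows [k < M] are exhausted by the first [M]
         columns and contribute [0]; only the rows from [M] on remain. *)
      destruct (Nat.le_gt_cases K M) as [HK|HK].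
      * rewrite (Csum_ext _ (fun _ => RtoC 0)).
        -- rewrite Csum_const, Cmult_0_r, Cmod_0.
           pose proof (Rsum_le_Series V M HV0 HVs). lra.
        -- intros k Hk. rewrite (Htri k M) by lia. ring.
      * assert (G : Cmod (Csum (fun k => Csum (u k) M - Csum (u k) (S k))%C K) <=
                    Rsum V K - Rsum V M).
        { induction HK as [|K HK IH].
          - rewrite (Csum_ext _ (fun k => if Nat.eq_dec k M then
                (Csum (u k) M - Csum (u k) (S k))%C else RtoC 0)).
            + rewrite (Csum_single _ (S M) M); [|lia|
                intros i _ Hi; destruct (Nat.eq_dec i M); [lia|reflexivity]].
              destruct (Nat.eq_dec M M); [|lia].
              change (Rsum V (S M)) with (Rsum V M + V M).
              pose proof (Htail M M ltac:(lia)). lra.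
            + intros k Hk. destruct (Nat.eq_dec k M) as [_|Hne]; [reflexivity|].
              rewrite (Htri k M) by lia. ring.
          - change (Rsum V (S K)) with (Rsum V K + V K).
            eapply Rle_trans; [apply (Cmod_triangle (Csum _ K))|].
            pose proof (Htail K M ltac:(lia)). lra. }
        pose proof (Rsum_le_Series V K HV0 HVs). lra.
  - replace (Finite 0) with (Finite (Series V - Series V)) by (f_equal; ring).
    apply is_lim_seq_minus'; [apply is_lim_seq_const | apply is_lim_seq_Rsum, HVs].
Qed.

(** Junk value unless the series of real and of imaginary parts converge. *)
Definition CSeries (u : nat -> C) : C :=
  (Series (fun n => Re (u n)), Series (fun n => Im (u n))).

Lemma Csum_Re_Im (u : nat -> C) (n : nat) :
  Csum u n = (Rsum (fun k => Re (u k)) n, Rsum (fun k => Im (u k)) n).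
Proof. induction n as [|n IH]; simpl; [reflexivity|]. rewrite IH. reflexivity. Qed.

Lemma Cseries_Re (u : nat -> C) (l : C) :
  Cseries u l -> is_series (fun n => Re (u n)) (Re l).
Proof.
  intros H. change (is_lim_seq (sum_n (fun n => Re (u n))) (Re l)).
  apply (is_lim_seq_ext (fun n => Rsum (fun k => Re (u k)) (S n))).
  { intros n. symmetry. apply sum_n_Rsum. }
  apply is_lim_seq_incr_1 with (u := Rsum (fun k => Re (u k))).
  apply is_lim_seq_ext with
    (fun n => (Rsum (fun k => Re (u k)) n - Re l) + Re l); [intros; ring|].
  replace (Finite (Re l)) with (Finite (0 + Re l)) by (f_equal; ring).
  apply is_lim_seq_plus'; [|apply is_lim_seq_const].
  apply is_lim_seq_abs_0.
  apply is_lim_seq_le_le with (fun _ => 0) (fun n => Cmod (Csum u n - l));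
    [|apply is_lim_seq_const | exact H].
  intros n. split; [apply Rabs_pos|].
  eapply Rle_trans; [|apply re_le_Cmod]. rewrite Csum_Re_Im. right. reflexivity.
Qed.

Lemma CSeries_unique (u : nat -> C) (l : C) : Cseries u l -> CSeries u = l.
Proof.
  intros H. unfold CSeries. rewrite (is_series_unique _ _ (Cseries_Re u l H)).
  (* The imaginary part of [w] is the real part of [- Ci * w], so [Cseries_Re] serves for both
     coordinates. *)
  apply (Cseries_mult_l (- Ci)%C) in H. apply Cseries_Re in H.
  apply is_series_unique in H.
  rewrite (Series_ext _ (fun n => Re (- Ci * u n)%C)), H.
  - destruct l as [x y]. unfold Re, Im, Ci, Cmult, Copp; simpl. f_equal. ring.
  - intros n. destruct (u n) as [x y]. unfold Re, Im, Ci, Cmult, Copp; simpl. ring.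
Qed.

Lemma CSeries_correct (u : nat -> C) :
  ex_series (fun n => Cmod (u n)) -> Cseries u (CSeries u).
Proof.
  intros H. destruct (Cseries_abs u H) as [l Hl]. rewrite (CSeries_unique u l Hl). exact Hl.
Qed.

Lemma CSeries_Cmod_le (u : nat -> C) (v : nat -> R) (B : R) :
  (forall n, Cmod (u n) <= v n) -> (forall n, Rsum v n <= B) ->
  Cmod (CSeries u) <= B.
Proof.
  intros Huv HB.
  assert (Hs : forall n, Rsum (fun k => Cmod (u k)) n <= B).
  { intros n. eapply Rle_trans; [|apply (HB n)]. apply Rsum_le. auto. }
  apply Cseries_Cmod_le with u.
  - apply CSeries_correct.
    apply (ex_series_Rsum_bounded _ B); [intros; apply Cmod_ge_0 | exact Hs].
  - intros n. eapply Rle_trans; [apply Cmod_Csum_le | apply Hs].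
Qed.

(** * Complex power series *)

Definition Cpser (a : nat -> C) (z l : C) : Prop := Cseries (fun k => a k * z ^ k)%C l.

Lemma pow_n_Cpow (z : C) (k : nat) : @pow_n C_Ring z k = (z ^ k)%C.
Proof. induction k as [|k IH]; simpl; [reflexivity|]. rewrite IH. reflexivity. Qed.

Lemma is_pseries_Cpser (a : nat -> C) (z l : C) :
  @is_pseries C_AbsRing C_NormedModule a z l <-> Cpser a z l.
Proof.
  unfold is_pseries. rewrite is_series_Cseries. unfold Cpser.
  split; apply Cseries_ext; intros n; rewrite <- pow_n_Cpow;
    unfold scal; simpl; apply Cmult_comm.
Qed.

Lemma Cseries_bounded (u : nat -> C) (l : C) :
  Cseries u l -> exists B, forall n, Cmod (u n) <= B.
Proof.
  intros H.
  destruct (filterlim_bounded (K := R_AbsRing) (V := R_NormedModule)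
              (fun n => Cmod (Csum u n - l))) as [B HB].
  { exists 0. exact H. }
  assert (HB' : forall n, Cmod (Csum u n - l) <= B).
  { intros n. eapply Rle_trans; [|apply (HB n)]. apply Rle_abs. }
  exists (B + B). intros n.
  replace (u n) with ((Csum u (S n) - l) + (- (Csum u n - l)))%C by (simpl; ring).
  eapply Rle_trans; [apply Cmod_triangle|]. rewrite Cmod_opp.
  pose proof (HB' n). pose proof (HB' (S n)). lra.
Qed.

Lemma ratio_bounds (t r : R) : 0 <= t < r -> 0 <= t / r < 1.
Proof.
  intros [H0 H1]. split; [apply Rdiv_le_0_compat; lra|].
  apply Rlt_div_l; lra.
Qed.

Lemma ex_series_pow_bound (a : nat -> C) (r t B : R) :
  0 <= t < r -> (forall k, Cmod (a k) * r ^ k <= B) ->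
  ex_series (fun k => Cmod (a k) * t ^ k).
Proof.
  intros Ht HB. pose proof (ratio_bounds t r Ht) as Hq.
  apply (@ex_series_le R_AbsRing R_CompleteNormedModule _ (fun k => B * (t / r) ^ k)).
  - intros k. change (Rabs (Cmod (a k) * t ^ k) <= B * (t / r) ^ k).
    rewrite Rabs_pos_eq by (apply Rmult_le_pos; [apply Cmod_ge_0 | apply pow_le; lra]).
    replace t with (r * (t / r)) at 1 by (field; lra).
    rewrite Rpow_mult_distr, <- Rmult_assoc.
    apply Rmult_le_compat_r; [apply pow_le; lra | apply HB].
  - apply (ex_series_scal B (fun k => (t / r) ^ k)). apply ex_series_geom.
    rewrite Rabs_pos_eq; lra.
Qed.

Lemma Rsum_geom_le (q : R) (n : nat) : 0 <= q < 1 -> Rsum (fun k => q ^ k) n <= / (1 - q).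
Proof.
  intros Hq. pose proof (is_series_geom q) as H.
  rewrite <- (is_series_unique _ _ (H ltac:(rewrite Rabs_pos_eq; lra))).
  apply Rsum_le_Series.
  - intros k. apply pow_le; lra.
  - apply ex_series_geom. rewrite Rabs_pos_eq; lra.
Qed.

(** [q^n] is the least of [1, q, ..., q^n], so the left side is at most their sum. *)
Lemma linear_geom_le (q : R) (n : nat) :
  0 <= q < 1 -> INR (S n) * q ^ n <= / (1 - q).
Proof.
  intros Hq. eapply Rle_trans; [|apply (Rsum_geom_le q (S n) Hq)].
  rewrite <- Rsum_const. apply Rsum_le. intros k Hk.
  replace n with (k + (n - k))%nat by lia. rewrite pow_add.
  rewrite <- (Rmult_1_r (q ^ k)) at 2.
  apply Rmult_le_compat_l; [apply pow_le; lra|].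
  rewrite <- (pow1 (n - k)). apply pow_incr. lra.
Qed.

(** The linear factor, which arises in [coef_bound_larger_disk], is absorbed by passing to the
    intermediate radius [(t + r) / 2]; no radius is lost. *)
Lemma ex_series_pow_linear_bound (a : nat -> C) (r t B : R) :
  0 <= t < r -> (forall k, Cmod (a k) * r ^ k <= INR (S k) * B) ->
  ex_series (fun k => Cmod (a k) * t ^ k).
Proof.
  intros Ht HB.
  assert (Hm : 0 <= (t + r) / 2 < r) by lra.
  pose proof (ratio_bounds _ r Hm) as Hq. set (q := (t + r) / 2 / r) in *.
  assert (HB0 : 0 <= B).
  { specialize (HB O). simpl in HB. pose proof (Cmod_ge_0 (a O)). lra. }
  apply ex_series_pow_bound with ((t + r) / 2) (B * / (1 - q)); [lra|].
  intros k.
  replace ((t + r) / 2) with (r * q) by (unfold q; field; lra).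
  rewrite Rpow_mult_distr, <- Rmult_assoc.
  apply Rle_trans with (INR (S k) * B * q ^ k).
  - apply Rmult_le_compat_r; [apply pow_le; lra | apply HB].
  - replace (INR (S k) * B * q ^ k) with (B * (INR (S k) * q ^ k)) by ring.
    apply Rmult_le_compat_l; [exact HB0 | apply linear_geom_le, Hq].
Qed.

Lemma Cpser_ex_series (a : nat -> C) (z l : C) (t : R) :
  Cpser a z l -> 0 <= t < Cmod z -> ex_series (fun k => Cmod (a k) * t ^ k).
Proof.
  intros H Ht. destruct (Cseries_bounded _ _ H) as [B HB].
  apply ex_series_pow_bound with (Cmod z) B; [exact Ht|].
  intros k. rewrite <- Cmod_pow, <- Cmod_mult. apply HB.
Qed.

Lemma Cpser_disk_ex_series (a : nat -> C) (f : C -> C) (rho t : R) :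
  (forall z, Cmod z < rho -> Cpser a z (f z)) -> 0 <= t < rho ->
  ex_series (fun k => Cmod (a k) * t ^ k).
Proof.
  intros H Ht.
  assert (Hm : Cmod (RtoC ((t + rho) / 2)) = (t + rho) / 2).
  { rewrite Cmod_R, Rabs_pos_eq; lra. }
  apply (Cpser_ex_series a _ _ t (H (RtoC ((t + rho) / 2)) ltac:(rewrite Hm; lra))).
  rewrite Hm. lra.
Qed.

Definition Cps (a : nat -> C) (z : C) : C := CSeries (fun k => a k * z ^ k)%C.

Lemma Cps_correct (a : nat -> C) (z : C) :
  ex_series (fun k => Cmod (a k) * Cmod z ^ k) -> Cpser a z (Cps a z).
Proof.
  intros H. apply CSeries_correct.
  apply ex_series_ext with (2 := H). intros k. rewrite Cmod_mult, Cmod_pow. reflexivity.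
Qed.

(** * Binomial expansion and recentering of power series *)

Fixpoint binom (n m : nat) : nat :=
  match n, m with
  | _, O => 1
  | O, S _ => 0
  | S n', S m' => binom n' m' + binom n' m
  end.

Lemma binom_0_r (n : nat) : binom n 0 = 1%nat.
Proof. destruct n; reflexivity. Qed.

(** This vanishing makes the double array in [Cpser_recenter] triangular. *)
Lemma binom_gt (n m : nat) : (n < m)%nat -> binom n m = 0%nat.
Proof.
  revert m. induction n as [|n IH]; intros [|m] H; simpl; try lia.
  rewrite !IH by lia. lia.
Qed.

Lemma binom_1_r (n : nat) : binom n 1 = n.
Proof. induction n as [|n IH]; simpl; [reflexivity|]. rewrite IH, binom_0_r. lia. Qed.

Lemma Cbinomial (x y : C) (n : nat) :
  Csum (fun m => RtoC (INR (binom n m)) * x ^ (n - m) * y ^ m)%C (S n) = ((x + y) ^ n)%C.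
Proof.
  induction n as [|n IH]; [simpl; ring|].
  rewrite Cpow_S, <- IH, Csum_split_first.
  replace ((x + y) * Csum (fun m => INR (binom n m) * x ^ (n - m) * y ^ m) (S n))%C
    with (Csum (fun m => x * (INR (binom n m) * x ^ (n - m) * y ^ m)) (S n) +
          Csum (fun m => y * (INR (binom n m) * x ^ (n - m) * y ^ m)) (S n))%C
    by (rewrite !Csum_mult_l; ring).
  rewrite (Csum_split_first (fun m => x * _)%C).
  rewrite (Csum_ext (fun k => INR (binom (S n) (S k)) * x ^ (S n - S k) * y ^ S k)%C
    (fun k => y * (INR (binom n k) * x ^ (n - k) * y ^ k) +
              INR (binom n (S k)) * x ^ (n - k) * y ^ S k)%C).
  - rewrite Csum_plus.
    change (Csum (fun k => INR (binom n (S k)) * x ^ (n - k) * y ^ S k)%C (S n)) with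
      (Csum (fun k => INR (binom n (S k)) * x ^ (n - k) * y ^ S k) n +
       INR (binom n (S n)) * x ^ (n - n) * y ^ S n)%C.
    rewrite (binom_gt n (S n)) by lia.
    rewrite (Csum_ext (fun k => INR (binom n (S k)) * x ^ (n - k) * y ^ S k)%C
      (fun k => x * (INR (binom n (S k)) * x ^ (n - S k) * y ^ S k))%C n).
    + rewrite !binom_0_r, !Nat.sub_0_r. simpl. ring.
    + intros k Hk. replace (n - k)%nat with (S (n - S k)) by lia. rewrite !Cpow_S. ring.
  - intros k _. replace (S n - S k)%nat with (n - k)%nat by lia.
    change (binom (S n) (S k)) with (binom n k + binom n (S k))%nat.
    rewrite plus_INR, RtoC_plus, !Cpow_S. ring.
Qed.

Lemma Rbinomial (x y : R) (n : nat) :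
  Rsum (fun m => INR (binom n m) * x ^ (n - m) * y ^ m) (S n) = (x + y) ^ n.
Proof.
  apply RtoC_inj. rewrite RtoC_pow, RtoC_plus, <- Cbinomial, <- Csum_RtoC.
  apply Csum_ext. intros k _. rewrite !RtoC_mult, !RtoC_pow. reflexivity.
Qed.

Lemma Rbinomial_term_le (x y : R) (n m : nat) :
  0 <= x -> 0 <= y -> INR (binom n m) * x ^ (n - m) * y ^ m <= (x + y) ^ n.
Proof.
  intros Hx Hy.
  assert (Hp : forall k, 0 <= INR (binom n k) * x ^ (n - k) * y ^ k).
  { intros k. repeat apply Rmult_le_pos; [apply pos_INR | apply pow_le, Hx | apply pow_le, Hy]. }
  destruct (Nat.le_gt_cases m n) as [H|H].
  - rewrite <- Rbinomial. eapply Rle_trans; [|apply (Rsum_incr _ (S m)); [exact Hp | lia]].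
    simpl Rsum. pose proof (Rsum_nonneg _ m Hp). lra.
  - rewrite binom_gt by lia. simpl INR. rewrite !Rmult_0_l. apply pow_le. lra.
Qed.

(** Coefficients of the [m]-th derivative divided by [m!]. *)
Definition Dcoef (m : nat) (a : nat -> C) (j : nat) : C :=
  (RtoC (INR (binom (j + m) m)) * a (j + m)%nat)%C.

Lemma Cmod_INR (n : nat) : Cmod (RtoC (INR n)) = INR n.
Proof. rewrite Cmod_R, Rabs_pos_eq; [reflexivity | apply pos_INR]. Qed.

(** The binomial factor is paid for with radius: a single term of the expansion of [(t + s)^(j+m)]
    gives [binom (j+m) m * t^j <= (t+s)^(j+m) / s^m], and [s = (rho - t) / 2] keeps [t + s] below
    [rho]. *)
Lemma Dcoef_ex_series (m : nat) (a : nat -> C) (rho t : R) :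
  (forall t, 0 <= t < rho -> ex_series (fun k => Cmod (a k) * t ^ k)) ->
  0 <= t < rho -> ex_series (fun j => Cmod (Dcoef m a j) * t ^ j).
Proof.
  intros H Ht. set (s := (rho - t) / 2). assert (Hs : 0 < s) by (unfold s; lra).
  apply (@ex_series_le R_AbsRing R_CompleteNormedModule _
    (fun j => / s ^ m * (Cmod (a (m + j)%nat) * (t + s) ^ (m + j)))).
  - intros j. change (Rabs (Cmod (Dcoef m a j) * t ^ j) <=
      / s ^ m * (Cmod (a (m + j)%nat) * (t + s) ^ (m + j))).
    rewrite Rabs_pos_eq by (apply Rmult_le_pos; [apply Cmod_ge_0 | apply pow_le; lra]).
    unfold Dcoef. rewrite Cmod_mult, Cmod_INR, (Nat.add_comm m j).
    pose proof (Rbinomial_term_le t s (j + m) m ltac:(lra) ltac:(lra)) as Hb.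
    replace (j + m - m)%nat with j in Hb by lia.
    pose proof (pow_lt s m Hs) as Hsm. pose proof (Cmod_ge_0 (a (j + m)%nat)) as Ha.
    apply (Rmult_le_reg_l (s ^ m)); [exact Hsm|].
    rewrite <- (Rmult_assoc (s ^ m) (/ s ^ m)), Rinv_r, Rmult_1_l by lra.
    replace (s ^ m * (INR (binom (j + m) m) * Cmod (a (j + m)%nat) * t ^ j)) with
      (Cmod (a (j + m)%nat) * (INR (binom (j + m) m) * t ^ j * s ^ m)) by ring.
    apply Rmult_le_compat_l; assumption.
  - apply (ex_series_scal (/ s ^ m) (fun j => Cmod (a (m + j)%nat) * (t + s) ^ (m + j))).
    apply -> (ex_series_incr_n (fun k => Cmod (a k) * (t + s) ^ k) m).
    apply H. unfold s; lra.
Qed.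

(** Each [(z0 + w)^k] is expanded by the binomial theorem and the order of summation exchanged. The
    rows are dominated by [|a k| (|z0| + |w|)^k], summable because [|z0| + |w| < rho]. *)
Lemma Cpser_recenter (a : nat -> C) (f : C -> C) (rho : R) (z0 w : C) :
  (forall z, Cmod z < rho -> Cpser a z (f z)) ->
  Cmod z0 + Cmod w < rho ->
  Cpser (fun m => Cps (Dcoef m a) z0) w (f (z0 + w)%C).
Proof.
  intros Hf Hw. pose proof (Cmod_ge_0 z0) as H0. pose proof (Cmod_ge_0 w) as H1.
  assert (Hex : forall t, 0 <= t < rho -> ex_series (fun k => Cmod (a k) * t ^ k)).
  { intros t Ht. apply (Cpser_disk_ex_series a f rho t Hf Ht). }
  apply Cseries_triangular_switch with
    (u := fun k m => (a k * (RtoC (INR (binom k m)) * z0 ^ (k - m) * w ^ m))%C)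
    (V := fun k => Cmod (a k) * (Cmod z0 + Cmod w) ^ k).
  - intros k m H. rewrite binom_gt by exact H. simpl INR. ring.
  - intros k. rewrite <- Rbinomial, <- Rsum_mult_l. right. apply Rsum_ext.
    intros m _. rewrite !Cmod_mult, !Cmod_pow, Cmod_INR. reflexivity.
  - apply Hex. lra.
  (* Column [m] starts at row [m]; with [k = j + m] it becomes [w^m] times the series of [Dcoef m a]
     at [z0]. *)
  - intros m. apply Cseries_shift with m.
    + intros k H. rewrite binom_gt by exact H. simpl INR. ring.
    + rewrite Cmult_comm.
      apply Cseries_ext with (fun j => w ^ m * (Dcoef m a j * z0 ^ j))%C.
      * intros j. unfold Dcoef. replace (j + m - m)%nat with j by lia. ring.
      * apply Cseries_mult_l. apply Cps_correct.
        apply (Dcoef_ex_series m a rho); [exact Hex | lra].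
  - apply Cseries_ext with (fun k => a k * (z0 + w) ^ k)%C.
    + intros k. rewrite Csum_mult_l, Cbinomial. reflexivity.
    + apply Hf. eapply Rle_lt_trans; [apply Cmod_triangle | exact Hw].
Qed.

(** * Bessel's inequality and Cauchy estimates *)

Definition cis (t : R) : C := (cos t, sin t).

Lemma cis_pow (t : R) (n : nat) : (cis t ^ n)%C = cis (INR n * t).
Proof.
  induction n as [|n IH].
  - unfold cis. simpl. rewrite Rmult_0_l, cos_0, sin_0. reflexivity.
  - rewrite Cpow_S, IH, S_INR, Rmult_plus_distr_r, Rmult_1_l, (Rplus_comm _ t).
    unfold cis, Cmult; simpl. rewrite cos_plus, sin_plus. f_equal. ring.
Qed.

Lemma Cmod_cis (t : R) : Cmod (cis t) = 1.
Proof.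
  unfold cis, Cmod; simpl. apply eq_trans with (sqrt 1); [f_equal | exact sqrt_1].
  pose proof (sin2_cos2 t) as H. unfold Rsqr in H. lra.
Qed.

Lemma Cmod1_conj (w : C) : Cmod w = 1 -> (w * Cconj w)%C = RtoC 1.
Proof. intros H. rewrite <- Cmod2_conj, H. f_equal. ring. Qed.

Lemma cis_eq_1 (t : R) : 0 < t < 2 * PI -> cis t <> RtoC 1.
Proof.
  intros Ht H. apply (f_equal fst) in H. simpl in H.
  replace t with (2 * (t / 2)) in H by field. rewrite cos_2a_sin in H.
  pose proof (sin_gt_0 (t / 2) ltac:(lra) ltac:(lra)). nra.
Qed.

Lemma Csum_geom_zero (q : C) (n : nat) :
  q <> RtoC 1 -> (q ^ n)%C = RtoC 1 -> Csum (fun j => q ^ j)%C n = RtoC 0.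
Proof.
  intros Hq Hn.
  assert (G : ((q - 1) * Csum (fun j => q ^ j) n = q ^ n - 1)%C).
  { clear Hn. induction n as [|n IH]; [simpl; ring|].
    change (Csum (fun j => q ^ j)%C (S n)) with (Csum (fun j => q ^ j) n + q ^ n)%C.
    rewrite Cmult_plus_distr_l, IH, Cpow_S. ring. }
  rewrite Hn in G. replace (RtoC 1 - RtoC 1)%C with (RtoC 0) in G by ring.
  assert (Hq' : (q - 1)%C <> RtoC 0).
  { intros E. apply Hq. replace q with ((q - 1) + 1)%C by ring. rewrite E. ring. }
  replace (Csum (fun j => q ^ j)%C n)
    with (/ (q - 1) * ((q - 1) * Csum (fun j => q ^ j) n))%C by (field; exact Hq').
  rewrite G. ring.
Qed.

(** The summand is the [j]-th power of [w^k * Cconj w^l], an [N]-th root of unity other than [1], so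
    the geometric sum vanishes. *)
Lemma root_of_unity_orthogonality (N k l : nat) :
  (k < N)%nat -> (l < N)%nat -> k <> l ->
  let w := cis (2 * PI / INR N) in
  Csum (fun j => (w ^ j) ^ k * Cconj ((w ^ j) ^ l))%C N = RtoC 0.
Proof.
  intros Hk Hl Hkl w.
  assert (HN : 0 < INR N) by (apply lt_0_INR; lia).
  assert (Hw : (w * Cconj w)%C = RtoC 1) by (apply Cmod1_conj, Cmod_cis).
  assert (HwN : (w ^ N)%C = RtoC 1).
  { unfold w. rewrite cis_pow. replace (INR N * (2 * PI / INR N)) with (2 * PI) by (field; lra).
    unfold cis. rewrite cos_2PI, sin_2PI. reflexivity. }
  assert (Hne : forall d, (0 < d < N)%nat -> (w ^ d)%C <> RtoC 1).
  { intros d Hd. unfold w. rewrite cis_pow. apply cis_eq_1.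
    assert (H0 : 0 < INR d) by (apply lt_0_INR; lia).
    assert (H1 : INR d < INR N) by (apply lt_INR; lia).
    pose proof PI_RGT_0 as Hpi.
    replace (INR d * (2 * PI / INR N)) with ((INR d / INR N) * (2 * PI)) by (field; lra).
    assert (H2 : 0 < INR d / INR N) by (apply Rdiv_lt_0_compat; lra).
    assert (H3 : INR d / INR N < 1) by (apply Rlt_div_l; lra).
    split; nra. }
  assert (Hcan : forall a b, (w ^ (a + b) * Cconj w ^ b)%C = (w ^ a)%C).
  { intros a b. rewrite Cpow_add_r, <- Cmult_assoc, <- Cpow_mult_l, Hw, Cpow_1_l. ring. }
  rewrite (Csum_ext _ (fun j => (w ^ k * Cconj w ^ l) ^ j)%C).
  - apply Csum_geom_zero.
    + intros E. destruct (Nat.lt_total k l) as [H|[H|H]]; [|lia|].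
      (* For [k < l] the equation is conjugated first, so that the surviving power of [w] has the
         natural exponent [l - k]. *)
      * apply (Hne (l - k)%nat); [lia|].
        apply (f_equal Cconj) in E. rewrite Cmult_conj, !Cpow_conj, Cconj_conj in E.
        rewrite <- (Hcan (l - k)%nat k). replace (l - k + k)%nat with l by lia.
        rewrite Cmult_comm, E. unfold Cconj, RtoC; simpl. f_equal. ring.
      * apply (Hne (k - l)%nat); [lia|].
        rewrite <- (Hcan (k - l)%nat l). replace (k - l + l)%nat with k by lia. exact E.
    + rewrite Cpow_mult_l, <- !Cpow_mult_r, (Nat.mul_comm k), (Nat.mul_comm l), !Cpow_mult_r.
      rewrite <- Cpow_conj, HwN, Cpow_1_l.
      replace (Cconj (RtoC 1)) with (RtoC 1)
        by (unfold Cconj, RtoC; simpl; f_equal; ring).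
      rewrite Cpow_1_l. ring.
  - intros j _. rewrite !Cpow_conj, Cpow_mult_l, <- !Cpow_mult_r.
    rewrite (Nat.mul_comm k), (Nat.mul_comm l). reflexivity.
Qed.

(** The squared moduli are expanded as double sums, and orthogonality leaves only the diagonal. The
    identity is exact because a polynomial of degree below [N] has no two exponents congruent modulo
    [N]. *)
Lemma discrete_parseval (c : nat -> C) (N : nat) :
  let w := cis (2 * PI / INR N) in
  Rsum (fun j => Cmod (Csum (fun k => c k * (w ^ j) ^ k)%C N) ^ 2) N =
  INR N * Rsum (fun k => Cmod (c k) ^ 2) N.
Proof.
  intros w. apply RtoC_inj. rewrite RtoC_mult, <- !Csum_RtoC.
  rewrite (Csum_ext _ (fun j => Csum (fun k => Csum (fun l =>
     (c k * Cconj (c l)) * ((w ^ j) ^ k * Cconj ((w ^ j) ^ l)))%C N) N)).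
  - rewrite Csum_switch. rewrite <- Csum_mult_l. apply Csum_ext. intros k Hk.
    rewrite Csum_switch. rewrite (Csum_single _ N k Hk).
    + rewrite (Csum_ext _ (fun _ => c k * Cconj (c k))%C).
      * rewrite Csum_const, Cmod2_conj. reflexivity.
      * intros j _. rewrite (Cmod1_conj ((w ^ j) ^ k)%C); [ring|].
        rewrite !Cmod_pow. unfold w. rewrite Cmod_cis, !pow1. reflexivity.
    + intros l Hl Hne. rewrite Csum_mult_l.
      unfold w. rewrite root_of_unity_orthogonality by auto. ring.
  - intros j _. rewrite Cmod2_conj.
    rewrite Csum_conj, Cmult_comm, <- Csum_mult_l. apply Csum_ext. intros k Hk.
    rewrite Cmult_comm, <- Csum_mult_l. apply Csum_ext. intros l Hl.
    rewrite Cmult_conj. ring.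
Qed.

Lemma bessel_polynomial (c : nat -> C) (N : nat) (B : R) :
  (forall w, Cmod w = 1 -> Cmod (Csum (fun k => c k * w ^ k)%C N) <= B) ->
  Rsum (fun k => Cmod (c k) ^ 2) N <= B ^ 2.
Proof.
  intros HB. destruct N as [|N]; [simpl; nra|].
  assert (HN : 0 < INR (S N)) by (apply lt_0_INR; lia).
  apply (Rmult_le_reg_l (INR (S N))); [exact HN|].
  rewrite <- discrete_parseval, <- Rsum_const. apply Rsum_le. intros j _.
  apply pow_incr. split; [apply Cmod_ge_0|]. apply HB.
  rewrite Cmod_pow, Cmod_cis, pow1. reflexivity.
Qed.

(** On the circle of radius [r] the [N]-th partial sum exceeds [M] by at most the tail of the series
    of [|a k| r^k], uniformly in [z]. The polynomial case applies to it, and [N] tends to infinity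
    with [K] fixed. *)
Lemma bessel_inequality (a : nat -> C) (f : C -> C) (rho r M : R) (K : nat) :
  (forall z, Cmod z < rho -> Cpser a z (f z)) ->
  (forall z, Cmod z < rho -> Cmod (f z) <= M) ->
  0 <= r < rho ->
  Rsum (fun k => Cmod (a k) ^ 2 * (r ^ k) ^ 2) K <= M ^ 2.
Proof.
  intros Hf HM Hr.
  set (v := fun k => Cmod (a k) * r ^ k).
  assert (Hv : ex_series v) by (apply (Cpser_disk_ex_series a f rho); assumption).
  assert (Hv0 : forall k, 0 <= v k).
  { intros k. apply Rmult_le_pos; [apply Cmod_ge_0 | apply pow_le; lra]. }
  assert (HM0 : 0 <= M).
  { eapply Rle_trans; [apply (Cmod_ge_0 (f (RtoC 0)))|]. apply HM. rewrite Cmod_0. lra. }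
  assert (Hstep : forall N, (K <= N)%nat ->
    Rsum (fun k => Cmod (a k) ^ 2 * (r ^ k) ^ 2) K <= (M + (Series v - Rsum v N)) ^ 2).
  { intros N HN.
    apply Rle_trans with (Rsum (fun k => Cmod (a k * RtoC (r ^ k))%C ^ 2) N).
    - eapply Rle_trans; [|apply (Rsum_incr _ K N); [intros; apply pow2_ge_0 | exact HN]].
      right. apply Rsum_ext. intros k _.
      rewrite Cmod_mult, Cmod_R, Rabs_pos_eq by (apply pow_le; lra). ring.
    - apply bessel_polynomial. intros w Hw.
      set (z := (RtoC r * w)%C).
      assert (Hz : Cmod z = r).
      { unfold z. rewrite Cmod_mult, Cmod_R, Hw, Rabs_pos_eq; lra. }
      rewrite (Csum_ext _ (fun k => a k * z ^ k)%C)
        by (intros k _; unfold z; rewrite Cpow_mult_l, RtoC_pow; ring).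
      replace (Csum (fun k => a k * z ^ k)%C N)
        with (f z - (f z - Csum (fun k => a k * z ^ k) N))%C by ring.
      eapply Rle_trans; [apply Cmod_triangle|]. rewrite Cmod_opp.
      apply Rplus_le_compat; [apply HM; lra|].
      (* The remainder is itself written as a convergent series, with the first [N] terms replaced
         by [0], so that bounding its partial sums suffices. *)
      apply Cseries_Cmod_le with
        (fun k => a k * z ^ k - (if Nat.ltb k N then a k * z ^ k else 0))%C.
      + apply Cseries_minus; [apply Hf; lra|].
        rewrite (Csum_ext _ (fun k => if Nat.ltb k N then a k * z ^ k else 0)%C).
        * apply Cseries_finite. intros k Hk.
          destruct (Nat.ltb_spec k N); [lia | reflexivity].
        * intros k Hk. destruct (Nat.ltb_spec k N); [reflexivity | lia].
      + intros n. eapply Rle_trans; [apply Cmod_Csum_le|].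
        assert (Hlim : Rsum v (Nat.max n N) <= Series v) by (apply Rsum_le_Series; assumption).
        assert (Hn : Rsum (fun k => Cmod (a k * z ^ k -
            (if Nat.ltb k N then a k * z ^ k else 0))%C) n + Rsum v (Nat.min n N)
            = Rsum v n).
        { clear Hlim HN. induction n as [|n IH]; [simpl; ring|].
          cbn [Rsum]. destruct (Nat.ltb_spec n N) as [H|H].
          - replace (a n * z ^ n - a n * z ^ n)%C with (RtoC 0) by ring. rewrite Cmod_0.
            rewrite !Nat.min_l in * by lia. cbn [Rsum]. lra.
          - replace (a n * z ^ n - 0)%C with (a n * z ^ n)%C by ring.
            rewrite Cmod_mult, Cmod_pow, Hz. fold (v n).
            rewrite !Nat.min_r in * by lia. lra. }
        destruct (Nat.le_gt_cases n N) as [H|H].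
        * rewrite Nat.min_l in Hn by lia. rewrite Nat.max_r in Hlim by lia. lra.
        * rewrite Nat.min_r in Hn by lia. rewrite Nat.max_l in Hlim by lia. lra. }
  apply (is_lim_seq_le_loc (fun _ => Rsum (fun k => Cmod (a k) ^ 2 * (r ^ k) ^ 2) K)
    (fun N => (M + (Series v - Rsum v N)) ^ 2)
    (Rsum (fun k => Cmod (a k) ^ 2 * (r ^ k) ^ 2) K) (M ^ 2)).
  - exists K. exact Hstep.
  - apply is_lim_seq_const.
  - assert (G : is_lim_seq (fun N => M + (Series v - Rsum v N)) M).
    { replace (Finite M) with (Finite (M + (Series v - Series v))) by (f_equal; ring).
      apply is_lim_seq_plus'; [apply is_lim_seq_const|].
      apply is_lim_seq_minus'; [apply is_lim_seq_const | apply is_lim_seq_Rsum, Hv]. }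
    apply is_lim_seq_ext with
      (fun N => (M + (Series v - Rsum v N)) * (M + (Series v - Rsum v N))); [intros; ring|].
    replace (Finite (M ^ 2)) with (Finite (M * M)) by (f_equal; ring).
    apply is_lim_seq_mult'; exact G.
Qed.

Lemma le_of_lt_limit (g : R -> R) (rho B : R) :
  0 < rho -> continuity_pt g rho -> (forall r, 0 <= r < rho -> g r <= B) -> g rho <= B.
Proof.
  intros Hrho Hc Hg.
  apply Rnot_lt_le. intros Hlt.
  destruct (Hc (g rho - B) ltac:(lra)) as [d [Hd H]].
  set (r := Rmax 0 (rho - d / 2)).
  assert (Hr : 0 <= r < rho).
  { unfold r. split; [apply Rmax_l | apply Rmax_lub_lt; lra]. }
  assert (Hr2 : rho - d / 2 <= r) by apply Rmax_r.
  assert (G : Rabs (g r - g rho) < g rho - B).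
  { apply H. split.
    - split; [exact I | lra].
    - unfold dist; simpl. unfold R_dist. rewrite Rabs_left; lra. }
  specialize (Hg r Hr). rewrite Rabs_left in G; lra.
Qed.

(** A single term of the Bessel sum at radius [r], with [r] then tending to [rho]. *)
Lemma cauchy_estimate (a : nat -> C) (f : C -> C) (rho M : R) (k : nat) :
  0 < rho ->
  (forall z, Cmod z < rho -> Cpser a z (f z)) ->
  (forall z, Cmod z < rho -> Cmod (f z) <= M) ->
  Cmod (a k) * rho ^ k <= M.
Proof.
  intros Hrho Hf HM.
  assert (HM0 : 0 <= M).
  { eapply Rle_trans; [apply (Cmod_ge_0 (f (RtoC 0)))|]. apply HM. rewrite Cmod_0. lra. }
  apply (le_of_lt_limit (fun r => Cmod (a k) * r ^ k) rho M Hrho).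
  - reg.
  - intros r Hr.
    pose proof (bessel_inequality a f rho r M (S k) Hf HM Hr) as H. cbn [Rsum] in H.
    pose proof (Rsum_nonneg (fun k => Cmod (a k) ^ 2 * (r ^ k) ^ 2) k
      ltac:(intros; apply Rmult_le_pos; apply pow2_ge_0)) as H0.
    apply Rsqr_incr_0_var; [|exact HM0]. unfold Rsqr. cbv beta in *. lra.
Qed.

(** The difference of the two series represents [0], and the Cauchy estimate with bound [0] kills
    its coefficients. *)
Lemma Cpser_unique (a b : nat -> C) (f : C -> C) (rho : R) (k : nat) :
  0 < rho ->
  (forall z, Cmod z < rho -> Cpser a z (f z)) ->
  (forall z, Cmod z < rho -> Cpser b z (f z)) -> a k = b k.
Proof.
  intros Hrho Ha Hb.
  assert (H : Cmod (a k - b k) * rho ^ k <= 0).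
  { apply (cauchy_estimate (fun k => a k - b k)%C (fun _ => RtoC 0) rho 0 k Hrho).
    - intros z Hz. replace (RtoC 0) with (f z - f z)%C by ring.
      apply Cseries_ext with (fun k => a k * z ^ k - b k * z ^ k)%C; [intros; ring|].
      apply Cseries_minus; [apply Ha | apply Hb]; exact Hz.
    - intros z _. rewrite Cmod_0. lra. }
  pose proof (pow_lt rho k Hrho) as Hp. pose proof (Cmod_ge_0 (a k - b k)) as H0.
  assert (E : Cmod (a k - b k) = 0) by nra.
  apply Cmod_eq_0 in E. replace (a k) with ((a k - b k) + b k)%C by ring. rewrite E. ring.
Qed.

(** * Taylor series of a bounded analytic function *)

(** Scaling [z] by [rho / (rho + delta)] leaves the complementary fraction [delta / (rho + delta)]
    of [z] as the difference. *)
Lemma small_center (z : C) (rho delta : R) :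
  0 < rho -> 0 < delta -> Cmod z < rho + delta ->
  exists z0, Cmod z0 < rho /\ Cmod (z - z0) < delta.
Proof.
  intros Hr Hd Hz. pose proof (Cmod_ge_0 z) as H0.
  exists (RtoC (rho / (rho + delta)) * z)%C. split.
  - rewrite Cmod_mult, Cmod_R, Rabs_pos_eq by (apply Rdiv_le_0_compat; lra).
    apply Rlt_le_trans with (rho / (rho + delta) * (rho + delta)).
    + apply Rmult_lt_compat_l; [apply Rdiv_lt_0_compat; lra | exact Hz].
    + right. field. lra.
  - replace (z - RtoC (rho / (rho + delta)) * z)%C with (RtoC (delta / (rho + delta)) * z)%C.
    + rewrite Cmod_mult, Cmod_R, Rabs_pos_eq by (apply Rdiv_le_0_compat; lra).
      apply Rlt_le_trans with (delta / (rho + delta) * (rho + delta)).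
      * apply Rmult_lt_compat_l; [apply Rdiv_lt_0_compat; lra | exact Hz].
      * right. field. lra.
    + replace (delta / (rho + delta)) with (1 - rho / (rho + delta)) by (field; lra).
      rewrite RtoC_minus. ring.
Qed.

(** The Cauchy estimate on the disks [D(z0, delta)] bounds the [m]-th derivative
    by [M / delta^m] on [D(0, rho)]; the Cauchy estimate for that derivative then
    gives [C(k,m) |a k| rho^(k-m) delta^m <= M], which is summed over [m]. *)
Lemma coef_bound_larger_disk (a : nat -> C) (f : C -> C) (rho delta M : R) :
  0 < rho -> 0 < delta ->
  (forall z, Cmod z < rho -> Cpser a z (f z)) ->
  (forall z0, Cmod z0 < rho ->
     exists c, forall w, Cmod w < delta -> Cpser c w (f (z0 + w)%C)) ->
  (forall z, Cmod z < rho + delta -> Cmod (f z) <= M) ->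
  forall k, Cmod (a k) * (rho + delta) ^ k <= INR (S k) * M.
Proof.
  intros Hr Hd Ha Hloc HM k.
  assert (Hex : forall t, 0 <= t < rho -> ex_series (fun k => Cmod (a k) * t ^ k)).
  { intros t Ht. apply (Cpser_disk_ex_series a f rho t Ha Ht). }
  assert (HD : forall m z0, Cmod z0 < rho -> Cmod (Cps (Dcoef m a) z0) <= M / delta ^ m).
  { intros m z0 Hz0. destruct (Hloc z0 Hz0) as [c Hc].
    assert (Hcm : Cmod (c m) * delta ^ m <= M).
    { apply (cauchy_estimate c (fun w => f (z0 + w)%C) delta M m Hd Hc).
      intros w Hw. apply HM. eapply Rle_lt_trans; [apply Cmod_triangle|]. lra. }
    (* The local expansion and the recentered series agree on the disk about [z0] of radius
       [min(delta, rho - |z0|)], so uniqueness transfers the bound. *)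
    replace (Cps (Dcoef m a) z0) with (c m).
    - apply Rle_div_r; [apply pow_lt, Hd | exact Hcm].
    - apply (Cpser_unique c (fun m => Cps (Dcoef m a) z0) (fun w => f (z0 + w)%C)
        (Rmin delta (rho - Cmod z0))).
      + apply Rmin_glb_lt; lra.
      + intros w Hw. apply Hc. eapply Rlt_le_trans; [exact Hw | apply Rmin_l].
      + intros w Hw. apply (Cpser_recenter a f rho); [exact Ha|].
        pose proof (Rmin_r delta (rho - Cmod z0)). lra. }
  rewrite <- Rbinomial, <- Rsum_mult_l, <- Rsum_const. apply Rsum_le. intros m Hm.
  assert (H : Cmod (Dcoef m a (k - m)) * rho ^ (k - m) <= M / delta ^ m).
  { apply (cauchy_estimate (Dcoef m a) (Cps (Dcoef m a)) rho); [exact Hr | | apply HD].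
    intros z Hz. apply Cps_correct. apply (Dcoef_ex_series m a rho); [exact Hex|].
    split; [apply Cmod_ge_0 | exact Hz]. }
  apply Rle_div_r in H; [|apply pow_lt, Hd].
  unfold Dcoef in H. rewrite Cmod_mult, Cmod_INR in H.
  replace (k - m + m)%nat with k in H by lia. lra.
Qed.

(** The coefficient bound makes the series converge on the larger disk, but its sum must still be
    identified with [f]. At a center [z0] of the old disk within [delta] of [z], both functions have
    the same expansion, and both expansions are valid at [z]. *)
Lemma Cpser_extend (a : nat -> C) (f : C -> C) (rho delta M : R) :
  0 < rho -> 0 < delta ->
  (forall z, Cmod z < rho -> Cpser a z (f z)) ->
  (forall z0, Cmod z0 < rho ->
     exists c, forall w, Cmod w < delta -> Cpser c w (f (z0 + w)%C)) ->
  (forall z, Cmod z < rho + delta -> Cmod (f z) <= M) ->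
  forall z, Cmod z < rho + delta -> Cpser a z (f z).
Proof.
  intros Hr Hd Ha Hloc HM.
  pose proof (coef_bound_larger_disk a f rho delta M Hr Hd Ha Hloc HM) as Hk.
  assert (Hps : forall z, Cmod z < rho + delta -> Cpser a z (Cps a z)).
  { intros z Hz. apply Cps_correct.
    apply ex_series_pow_linear_bound with (rho + delta) M; [|exact Hk].
    split; [apply Cmod_ge_0 | exact Hz]. }
  intros z Hz. replace (f z) with (Cps a z); [apply Hps, Hz|].
  destruct (small_center z rho delta Hr Hd Hz) as [z0 [H0 H1]].
  destruct (Hloc z0 H0) as [c Hc].
  assert (Hcm : forall m, c m = Cps (Dcoef m a) z0).
  { intros m.
    apply (Cpser_unique c (fun m => Cps (Dcoef m a) z0) (fun w => f (z0 + w)%C)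
        (Rmin delta (rho - Cmod z0))).
    - apply Rmin_glb_lt; lra.
    - intros w Hw. apply Hc. eapply Rlt_le_trans; [exact Hw | apply Rmin_l].
    - intros w Hw. apply (Cpser_recenter a f rho); [exact Ha|].
      pose proof (Rmin_r delta (rho - Cmod z0)). lra. }
  specialize (Hc (z - z0)%C H1).
  replace (z0 + (z - z0))%C with z in Hc by ring.
  apply Cseries_unique with (2 := Hc).
  apply Cseries_ext with (fun m => Cps (Dcoef m a) z0 * (z - z0) ^ m)%C.
  { intros m. rewrite Hcm. reflexivity. }
  replace (Cps a z) with (Cps a (z0 + (z - z0))%C) by (f_equal; ring).
  apply (Cpser_recenter a (Cps a) (rho + delta)); [exact Hps|]. lra.
Qed.

(** Halving the radius lets all centers near [z] share one radius of expansion: the series at [z] is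
    recentered at each of them. This local uniformity is what compactness needs. *)
Lemma analytic_local (f : C -> C) (z : C) :
  analytic_on_disk f -> Cmod z < 1 ->
  exists r : posreal, forall z0, Cmod (z0 - z) < r ->
    exists c, forall w, Cmod w < r -> Cpser c w (f (z0 + w)%C).
Proof.
  intros Hf Hz. destruct (Hf z Hz) as (r & c & Hr & Hc).
  assert (H2 : 0 < r / 2) by lra.
  exists (mkposreal _ H2). intros z0 H0. simpl in *.
  exists (fun m => Cps (Dcoef m c) (z0 - z)%C). intros w Hw.
  replace (z0 + w)%C with (z + ((z0 - z) + w))%C by ring.
  apply (Cpser_recenter c (fun v => f (z + v)%C) r); [|lra].
  intros v Hv. apply is_pseries_Cpser.
  replace v with ((z + v) - z)%C at 1 by ring. apply Hc.
  replace ((z + v) - z)%C with v by ring. exact Hv.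
Qed.

Lemma Cmod_le_Rabs (x y : R) : Cmod (x, y) <= Rabs x + Rabs y.
Proof.
  replace ((x, y) : C) with (RtoC x + Ci * RtoC y)%C
    by (unfold RtoC, Ci, Cplus, Cmult; simpl; f_equal; ring).
  eapply Rle_trans; [apply Cmod_triangle|].
  rewrite Cmod_mult, Cmod_Ci, !Cmod_R. lra.
Qed.

Lemma Rabs_re_im_le (z : C) : Rabs (fst z) <= Cmod z /\ Rabs (snd z) <= Cmod z.
Proof.
  pose proof (Rmax_Cmod z) as H. split; eapply Rle_trans; [apply Rmax_l | exact H | apply Rmax_r | exact H].
Qed.

Lemma analytic_uniform_radius (f : C -> C) (R0 : R) :
  analytic_on_disk f -> 0 < R0 < 1 ->
  exists delta, 0 < delta /\ forall z0, Cmod z0 <= R0 ->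
    exists c, forall w, Cmod w < delta -> Cpser c w (f (z0 + w)%C).
Proof.
  intros Hf HR.
  (* Compactness is applied on the square [[-1,1]^2], so points outside the disk also need a radius;
     theirs is too small to reach any center with [|z0| <= R0]. The factor [2] accounts for
     coordinatewise closeness: each coordinate within [r] gives modulus below [2 * r]. *)
  assert (Hch : forall u v : R, exists r : posreal,
    (Cmod (u, v) < 1 -> forall z0, Cmod (z0 - (u, v)) < 2 * r ->
      exists c, forall w, Cmod w < r -> Cpser c w (f (z0 + w)%C)) /\
    (1 <= Cmod (u, v) -> 2 * r <= 1 - R0)).
  { intros u v. destruct (Rlt_le_dec (Cmod (u, v)) 1) as [H|H].
    - destruct (analytic_local f (u, v) Hf H) as [r Hr].
      pose proof (cond_pos r) as Hr0.
      assert (H2 : 0 < r / 2) by lra.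
      exists (mkposreal _ H2). simpl. split; [|lra].
      intros _ z0 H0. destruct (Hr z0 ltac:(lra)) as [c Hc].
      exists c. intros w Hw. apply Hc. lra.
    - assert (H2 : 0 < (1 - R0) / 2) by lra.
      exists (mkposreal _ H2). simpl. split; intros; lra. }
  set (g := fun u v => proj1_sig (constructive_indefinite_description _ (Hch u v))).
  assert (Hg : forall u v,
    (Cmod (u, v) < 1 -> forall z0, Cmod (z0 - (u, v)) < 2 * g u v ->
      exists c, forall w, Cmod w < g u v -> Cpser c w (f (z0 + w)%C)) /\
    (1 <= Cmod (u, v) -> 2 * g u v <= 1 - R0)).
  { intros u v. exact (proj2_sig (constructive_indefinite_description _ (Hch u v))). }
  clearbody g.
  destruct (compactness_value_2d (-1) 1 (-1) 1 g) as [d Hd].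
  exists d. split; [apply cond_pos|]. intros z0 Hz0.
  destruct (Rabs_re_im_le z0) as [H1 H2].
  (* The compactness lemma yields its covering point under a double negation, hence the argument by
     contradiction. *)
  apply NNPP. intros Hn.
  apply (Hd (fst z0) (snd z0)).
  { apply Rabs_le_between. lra. }
  { apply Rabs_le_between. lra. }
  intros (u & v & _ & _ & Hu & Hv & Hduv). apply Hn.
  destruct (Hg u v) as [G1 G2].
  assert (Hdist : Cmod (z0 - (u, v)) < 2 * g u v).
  { destruct z0 as [x y]. simpl in Hu, Hv.
    change (Cmod (x - u, y - v) < 2 * g u v).
    pose proof (Cmod_le_Rabs (x - u) (y - v)). lra. }
  destruct (Rlt_le_dec (Cmod (u, v)) 1) as [H|H].
  - destruct (G1 H z0 Hdist) as [c Hc]. exists c. intros w Hw. apply Hc. lra.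
  - exfalso. specialize (G2 H).
    assert (T : Cmod (u, v) <= Cmod z0 + Cmod (z0 - (u, v))).
    { replace ((u, v) : C) with (z0 + (- (z0 - (u, v))))%C at 1 by ring.
      eapply Rle_trans; [apply Cmod_triangle|]. rewrite Cmod_opp. lra. }
    lra.
Qed.

Lemma taylor_on_disk (f : C -> C) (M : R) :
  analytic_on_disk f -> (forall z, in_disk z -> Cmod (f z) <= M) ->
  exists a, forall z, in_disk z -> Cpser a z (f z).
Proof.
  intros Hf HM.
  destruct (analytic_local f (RtoC 0) Hf ltac:(rewrite Cmod_0; lra)) as [r0 Hr0].
  destruct (Hr0 (RtoC 0)) as [a Ha].
  { replace (RtoC 0 - RtoC 0)%C with (RtoC 0) by ring. rewrite Cmod_0. apply cond_pos. }
  assert (Ha0 : forall z, Cmod z < r0 -> Cpser a z (f z)).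
  { intros z Hz. rewrite <- (Cplus_0_l z) at 2. apply Ha, Hz. }
  clear Ha. exists a. intros z Hz. unfold in_disk in Hz.
  pose proof (cond_pos r0) as Hr0p. pose proof (Cmod_ge_0 z) as Hz0.
  set (R0 := (Cmod z + 1) / 2).
  destruct (analytic_uniform_radius f R0 Hf) as [d [Hd Hloc]]; [unfold R0; lra|].
  (* The cap [R0] keeps the centers where the radius [d] is available; the step is at most [1 - R0],
     so each enlarged disk stays inside the unit disk, where [M] bounds [f]. *)
  set (rho := fun n : nat => Rmin R0 (Rmin r0 1 + INR n * Rmin d ((1 - R0)))).
  assert (He : 0 < Rmin d (1 - R0)) by (apply Rmin_glb_lt; unfold R0; lra).
  assert (Hstep : forall n z, Cmod z < rho n -> Cpser a z (f z)).
  { induction n as [|n IH].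
    - intros y Hy. apply Ha0. unfold rho in Hy. simpl INR in Hy. rewrite Rmult_0_l, Rplus_0_r in Hy.
      pose proof (Rmin_r R0 (Rmin r0 1)). pose proof (Rmin_l r0 1). lra.
    - intros y Hy.
      assert (Hp : 0 < rho n).
      { apply Rmin_glb_lt; [unfold R0; lra|].
        apply Rplus_lt_le_0_compat; [apply Rmin_glb_lt; lra|].
        apply Rmult_le_pos; [apply pos_INR | lra]. }
      assert (Hle : rho n <= R0) by apply Rmin_l.
      apply (Cpser_extend a f (rho n) (Rmin d (1 - R0)) M Hp He IH).
      + intros z0 H0. destruct (Hloc z0 ltac:(lra)) as [c Hc]. exists c.
        intros w Hw. apply Hc. pose proof (Rmin_l d (1 - R0)). lra.
      + intros y' Hy'. apply HM. unfold in_disk. pose proof (Rmin_r d (1 - R0)). lra.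
      + eapply Rlt_le_trans; [exact Hy|]. unfold rho. rewrite S_INR.
        set (e := Rmin d (1 - R0)) in *. set (B := Rmin r0 1 + INR n * e).
        replace (Rmin r0 1 + (INR n + 1) * e) with (B + e) by (unfold B; ring).
        pose proof (Rmin_l R0 (B + e)). pose proof (Rmin_r R0 (B + e)).
        apply (Rmin_case R0 B (fun t => Rmin R0 (B + e) <= t + e)); lra. }
  destruct (INR_unbounded (1 / Rmin d (1 - R0))) as [n Hn].
  apply (Hstep n). unfold rho. apply Rmin_glb_lt; [unfold R0; lra|].
  apply Rlt_div_l in Hn; [|exact He].
  pose proof (Rmin_glb_lt r0 1 0 Hr0p ltac:(lra)). lra.
Qed.

(** * Coefficients of the Hilbert transform *)

(** Telescoping, from [1/(x+1)^2 <= 1/x - 1/(x+1)]. *)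
Lemma Rsum_inv_square_le (n : nat) : Rsum (fun k => / INR (S k) ^ 2) (S n) <= 2 - / INR (S n).
Proof.
  induction n as [|n IH]; [simpl; lra|].
  change (Rsum (fun k => / INR (S k) ^ 2) (S n) + / INR (S (S n)) ^ 2 <= 2 - / INR (S (S n))).
  assert (H : 0 < INR (S n)) by (apply lt_0_INR; lia).
  rewrite (S_INR (S n)). set (x := INR (S n)) in *.
  assert (G : / x - / (x + 1) - / (x + 1) ^ 2 = / (x * (x + 1) ^ 2)) by (field; lra).
  assert (G2 : 0 < / (x * (x + 1) ^ 2)).
  { apply Rinv_0_lt_compat. apply Rmult_lt_0_compat; [lra | apply pow_lt; lra]. }
  lra.
Qed.

Lemma taylor_coef_square_summable (a : nat -> C) (f : C -> C) (M : R) (K : nat) :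
  (forall z, in_disk z -> Cpser a z (f z)) ->
  (forall z, in_disk z -> Cmod (f z) <= M) ->
  Rsum (fun k => Cmod (a k) ^ 2) K <= M ^ 2.
Proof.
  intros Ha HM.
  assert (G : Rsum (fun k => Cmod (a k) ^ 2 * (1 ^ k) ^ 2) K <= M ^ 2).
  { apply (le_of_lt_limit (fun r => Rsum (fun k => Cmod (a k) ^ 2 * (r ^ k) ^ 2) K) 1); [lra| |].
    - induction K as [|K IH]; simpl Rsum; [reg|].
      apply continuity_pt_plus; [exact IH|]. reg.
    - intros r Hr. apply (bessel_inequality a f 1); assumption. }
  eapply Rle_trans; [|exact G]. right. apply Rsum_ext. intros k _. rewrite pow1. ring.
Qed.

(** The terms are at most [|a k|^2 + 1/(k+1)^2]. Bounded coefficients alone would give only a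
    harmonic majorant, hence the square summability. *)
Lemma hilbert_coef_abs_convergent (a : nat -> C) (M : R) (n : nat) :
  (forall K, Rsum (fun k => Cmod (a k) ^ 2) K <= M ^ 2) ->
  ex_series (fun k => Cmod (a k / RtoC (INR (n + k + 1)))).
Proof.
  intros H. apply (ex_series_Rsum_bounded _ (M ^ 2 + 2)); [intros; apply Cmod_ge_0|].
  intros K. apply Rle_trans with
    (Rsum (fun k => Cmod (a k) ^ 2) K + Rsum (fun k => / INR (S k) ^ 2) K).
  - induction K as [|K IH]; [simpl; lra|]. cbn [Rsum].
    assert (G : Cmod (a K / RtoC (INR (n + K + 1))) <= Cmod (a K) ^ 2 + / INR (S K) ^ 2).
    { assert (H1 : 0 < INR (S K)) by (apply lt_0_INR; lia).
      assert (H2 : INR (S K) <= INR (n + K + 1)) by (apply le_INR; lia).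
      rewrite Cmod_div, Cmod_INR by (intros E; apply RtoC_inj in E; lra).
      apply Rle_trans with (Cmod (a K) * / INR (S K)).
      - apply Rmult_le_compat_l; [apply Cmod_ge_0 | apply Rinv_le_contravar; lra].
      - rewrite <- pow_inv. pose proof (Cmod_ge_0 (a K)).
        pose proof (Rinv_0_lt_compat _ H1). nra. }
    lra.
  - apply Rplus_le_compat; [apply H|]. destruct K as [|K]; [simpl; lra|].
    eapply Rle_trans; [apply Rsum_inv_square_le|].
    pose proof (Rinv_0_lt_compat (INR (S K)) ltac:(apply lt_0_INR; lia)). lra.
Qed.

(** * Real power series up to the endpoint [1], and the moment bound *)

Lemma CV_radius_ge_1 (a : nat -> R) (B : R) :
  (forall k, Rabs (a k) <= B) -> Rbar_le 1 (CV_radius a).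
Proof.
  intros H. apply (proj1 (CV_radius_bounded a)). exists B. intros n.
  rewrite pow1, Rmult_1_r. apply H.
Qed.

(** Left continuity at [1] comes from Abel's theorem when the radius of convergence is exactly [1],
    and from continuity inside the disk of convergence when it is larger. *)
Lemma PSeries_le_at_1 (d : nat -> R) (B : R) :
  Rbar_le 1 (CV_radius d) -> ex_series d ->
  (forall s, 0 <= s < 1 -> PSeries d s <= B) -> PSeries d 1 <= B.
Proof.
  intros Hr Hd HB. apply Rnot_lt_le. intros Hlt.
  assert (Hleft : filterlim (PSeries d) (at_left 1) (locally (PSeries d 1))).
  { destruct (Rbar_le_lt_or_eq_dec _ _ Hr) as [H|H].
    - apply (@filterlim_filter_le_1 _ _ (locally 1)).
      { intros P HP. unfold at_left, within. apply filter_imp with (2 := HP). auto. }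
      apply (continuity_pt_filterlim (PSeries d) 1). apply PSeries_continuity.
      rewrite Rabs_R1. exact H.
    - pose proof (Abel d) as HA. rewrite <- H in HA. apply HA.
      + simpl; lra.
      + exact I.
      + apply ex_pseries_1. exact Hd. }
  assert (Hev : at_left 1 (fun s => B < PSeries d s)).
  { apply Hleft. apply open_gt. exact Hlt. }
  destruct Hev as [e He].
  set (s := Rmax 0 (1 - e / 2)). pose proof (cond_pos e) as Hep.
  assert (Hs : 0 <= s < 1) by (unfold s; split; [apply Rmax_l | apply Rmax_lub_lt; lra]).
  assert (Hs2 : 1 - e / 2 <= s) by apply Rmax_r.
  specialize (HB s Hs).
  assert (G : B < PSeries d s); [|lra].
  apply He; [|lra]. change (Rabs (s - 1) < e). rewrite Rabs_left; lra.
Qed.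

(** [b_n] is the [n]-th moment of [f] on [[0,1]]: the primitive of [x^n Re (u f x)]
    is at most [M x^(n+1) / (n+1)]. *)
Lemma hilbert_coef_Re_le (a : nat -> C) (f : C -> C) (M : R) (n : nat) (bn u : C) :
  (forall z, in_disk z -> Cpser a z (f z)) ->
  (forall z, in_disk z -> Cmod (f z) <= M) ->
  Cseries (fun k => a k / RtoC (INR (n + k + 1)))%C bn ->
  Cmod u = 1 -> Re (u * bn)%C <= M / INR (S n).
Proof.
  intros Ha HM Hb Hu.
  assert (HM0 : 0 <= M).
  { eapply Rle_trans; [apply (Cmod_ge_0 (f (RtoC 0)))|]. apply HM.
    unfold in_disk. rewrite Cmod_0. lra. }
  set (A := fun k => Re (u * a k)%C).
  assert (HA : forall k, Rabs (A k) <= M).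
  { intros k. eapply Rle_trans; [apply re_le_Cmod|]. rewrite Cmod_mult, Hu, Rmult_1_l.
    pose proof (cauchy_estimate a f 1 M k ltac:(lra) Ha HM) as H. rewrite pow1 in H. lra. }
  assert (HAn : forall k, Rabs (PS_incr_n A n k) <= M).
  { intros k. rewrite PS_incr_n_simplify. destruct Compare_dec.le_lt_dec; [apply HA|].
    unfold zero; simpl. rewrite Rabs_R0. exact HM0. }
  (* The series of the primitive: its coefficient of index [n + k + 1] is [A k / (n + k + 1)] and
     those of lower index vanish, so its sum at [1] is [Re (u * bn)]. *)
  set (d := PS_Int (PS_incr_n A n)).
  assert (Hrad : Rbar_le 1 (CV_radius d)).
  { unfold d. rewrite CV_radius_Int. exact (CV_radius_ge_1 _ M HAn). }
  assert (HPA : forall x, 0 <= x < 1 -> PSeries A x <= M).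
  { intros x Hx.
    assert (Hd : in_disk (RtoC x)) by (unfold in_disk; rewrite Cmod_R, Rabs_pos_eq; lra).
    assert (E : PSeries A x = Re (u * f (RtoC x))%C).
    { apply is_pseries_unique. apply is_pseries_R.
      pose proof (Cseries_Re _ _ (Cseries_mult_l u _ _ (Ha _ Hd))) as G.
      apply is_series_ext with (2 := G). intros k. unfold A.
      rewrite <- RtoC_pow. unfold Re, Cmult, RtoC; simpl. ring. }
    rewrite E. eapply Rle_trans; [apply Rle_abs|].
    eapply Rle_trans; [apply re_le_Cmod|]. rewrite Cmod_mult, Hu, Rmult_1_l. apply HM, Hd. }
  assert (Hder : forall x, 0 <= x < 1 -> is_derive (PSeries d) x (x ^ n * PSeries A x)).
  { intros x Hx.
    assert (Hx' : Rbar_lt (Rabs x) (CV_radius d)).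
    { apply Rbar_lt_le_trans with 1; [simpl; rewrite Rabs_pos_eq; lra | exact Hrad]. }
    pose proof (is_derive_PSeries d x Hx') as G.
    rewrite (PSeries_ext (PS_derive d) (PS_incr_n A n)) in G.
    - rewrite PSeries_incr_n in G. exact G.
    - intros k. unfold PS_derive, d, PS_Int. field. apply not_0_INR. lia. }
  assert (Hsum : is_series d (Re (u * bn)%C)).
  { apply is_series_ext with (fun j => Re (match j with O => RtoC 0 | S i =>
        if Compare_dec.le_lt_dec n i then u * (a (i - n)%nat / RtoC (INR (S i))) else RtoC 0 end)%C).
    - intros [|i]; [reflexivity|]. unfold d, PS_Int. rewrite PS_incr_n_simplify.
      assert (Hi : INR (S i) <> 0) by (apply not_0_INR; lia).
      destruct Compare_dec.le_lt_dec.
      + unfold A, Cdiv. rewrite <- RtoC_inv by exact Hi.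
        unfold Re, Cmult, RtoC; simpl.
        match goal with |- ?x = ?y => change (@eq R x y) end. field. exact Hi.
      + symmetry. apply Rmult_0_l.
    - apply Cseries_Re. apply Cseries_shift with (S n).
      + intros [|i] Hi; [reflexivity|]. destruct Compare_dec.le_lt_dec; [lia | reflexivity].
      + apply Cseries_ext with (fun k => u * (a k / RtoC (INR (n + k + 1))))%C.
        * intros k. replace (k + S n)%nat with (S (k + n)) by lia. cbv beta iota.
          destruct (Compare_dec.le_lt_dec n (k + n)); [|lia].
          replace (k + n - n)%nat with k by lia.
          replace (n + k + 1)%nat with (S (k + n)) by lia. reflexivity.
        * apply Cseries_mult_l, Hb. }
  rewrite <- (is_series_unique _ _ Hsum), <- PSeries_1.
  apply PSeries_le_at_1; [exact Hrad | eexists; exact Hsum |].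
  intros s Hs.
  assert (HSn : 0 < INR (S n)) by (apply lt_0_INR; lia).
  destruct (Req_dec s 0) as [->|Hs0].
  { rewrite PSeries_0. unfold d. simpl PS_Int. apply Rdiv_le_0_compat; lra. }
  (* [h] vanishes at [0] and has derivative [x^n (PSeries A x - M) <= 0], so the mean value theorem
     gives [h s <= 0]. *)
  set (h := fun x => PSeries d x - M / INR (S n) * x ^ S n).
  destruct (MVT_gen h 0 s (fun x => x ^ n * PSeries A x - M * x ^ n)) as [c [Hc Hmvt]].
  - intros x Hx. rewrite Rmin_left, Rmax_right in Hx by lra.
    assert (G : is_derive (fun x => M / INR (S n) * x ^ S n) x (M * x ^ n)).
    { replace (M * x ^ n) with (M / INR (S n) * (INR (S n) * x ^ n)) by (field; lra).
      generalize (M / INR (S n)). intros q. auto_derive; [exact I|].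
      change (match n with O => 1 | S _ => INR n + 1 end) with (INR (S n)).
      simpl Nat.pred. ring. }
    apply (is_derive_minus (PSeries d) _ x _ _ (Hder x ltac:(lra)) G).
  - intros x Hx. rewrite Rmin_left, Rmax_right in Hx by lra.
    apply continuity_pt_minus; [|reg].
    apply PSeries_continuity.
    apply Rbar_lt_le_trans with 1; [simpl; rewrite Rabs_pos_eq; lra | exact Hrad].
  - rewrite Rmin_left, Rmax_right in Hc by lra. unfold h in Hmvt.
    rewrite PSeries_0 in Hmvt. change (d O) with 0 in Hmvt.
    rewrite (pow_i (S n)) in Hmvt by lia.
    assert (H1 : (c ^ n * PSeries A c - M * c ^ n) * (s - 0) <= 0).
    { pose proof (HPA c ltac:(lra)) as H. pose proof (pow_le c n ltac:(lra)) as Hp.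
      pose proof (Rmult_le_pos _ _ Hp (Rmult_le_pos (M - PSeries A c) s ltac:(lra) ltac:(lra))).
      lra. }
    assert (H2 : M / INR (S n) * s ^ S n <= M / INR (S n) * 1).
    { apply Rmult_le_compat_l; [apply Rdiv_le_0_compat; lra|].
      rewrite <- (pow1 (S n)). apply pow_incr. lra. }
    lra.
Qed.

(** For nonzero [bn], the unimodular [u = Cconj bn / |bn|] turns the modulus into the real part of
    [u * bn]. *)
Lemma hilbert_coef_le (a : nat -> C) (f : C -> C) (M : R) (n : nat) (bn : C) :
  (forall z, in_disk z -> Cpser a z (f z)) ->
  (forall z, in_disk z -> Cmod (f z) <= M) ->
  Cseries (fun k => a k / RtoC (INR (n + k + 1)))%C bn ->
  Cmod bn <= M / INR (S n).
Proof.
  intros Ha HM Hb. destruct (Req_dec (Cmod bn) 0) as [H0|H0].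
  - rewrite H0. apply Rdiv_le_0_compat; [|apply lt_0_INR; lia].
    eapply Rle_trans; [apply (Cmod_ge_0 (f (RtoC 0)))|]. apply HM.
    unfold in_disk. rewrite Cmod_0. lra.
  - assert (Hp : 0 < Cmod bn) by (pose proof (Cmod_ge_0 bn); lra).
    set (u := (RtoC (/ Cmod bn) * Cconj bn)%C).
    assert (Hu : Cmod u = 1).
    { unfold u. rewrite Cmod_mult, Cmod_conj, Cmod_R, Rabs_pos_eq.
      - field. lra.
      - left. apply Rinv_0_lt_compat, Hp. }
    replace (Cmod bn) with (Re (u * bn)%C).
    + apply (hilbert_coef_Re_le a f M n bn u Ha HM Hb Hu).
    + unfold u. rewrite <- Cmult_assoc, (Cmult_comm (Cconj bn)), <- Cmod2_conj.
      rewrite <- RtoC_mult. simpl. field. lra.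
Qed.

(** * Bloch norms *)

Lemma Cseries_first (u : nat -> C) : (forall k, u (S k) = RtoC 0) -> Cseries u (u O).
Proof.
  intros H. replace (u O) with (Csum u 1) at 1 by (simpl; ring).
  apply Cseries_finite. intros [|k] Hk; [lia | apply H].
Qed.

Lemma Cpser_first (a : nat -> C) (z : C) :
  (forall k, a (S k) = RtoC 0) -> Cpser a z (a O).
Proof.
  intros H. replace (a O) with (a O * z ^ 0)%C by (simpl; ring).
  apply (Cseries_first (fun k => a k * z ^ k)%C). intros k. rewrite H. ring.
Qed.

Lemma Cpser_at_0 (a : nat -> C) (l : C) : Cpser a (RtoC 0) l -> l = a O.
Proof.
  intros H. replace (a O) with (a O * RtoC 0 ^ 0)%C by (simpl; ring).
  apply Cseries_unique with (1 := H).
  apply (Cseries_first (fun k => a k * RtoC 0 ^ k)%C). intros k. rewrite Cpow_S. ring.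
Qed.

(** For [k >= 2] and [|w| <= t], [|w|^k <= |w|^2 t^(k-2)], which compares the remainder with the
    series at radius [t]. *)
Lemma Cpser_quadratic_remainder (c : nat -> C) (t K : R) (w l : C) :
  0 < t -> Cmod w <= t -> Cpser c w l ->
  (forall n, Rsum (fun k => Cmod (c k) * t ^ k) n <= K) ->
  Cmod (l - (c 0%nat + c 1%nat * w)) <= Cmod w ^ 2 * (K / t ^ 2).
Proof.
  intros Ht Hw Hl HK. pose proof (Cmod_ge_0 w) as Hw0.
  apply Cseries_Cmod_le with
    (fun k => c k * w ^ k - (if Nat.ltb k 2 then c k * w ^ k else 0))%C.
  - apply Cseries_minus; [exact Hl|].
    replace (c 0%nat + c 1%nat * w)%C
      with (Csum (fun k => if Nat.ltb k 2 then c k * w ^ k else 0)%C 2) by (simpl; ring).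
    apply Cseries_finite. intros k Hk. destruct (Nat.ltb_spec k 2); [lia | reflexivity].
  - intros n. eapply Rle_trans; [apply Cmod_Csum_le|].
    apply Rle_trans with (Cmod w ^ 2 / t ^ 2 * Rsum (fun k => Cmod (c k) * t ^ k) n).
    + rewrite <- Rsum_mult_l. apply Rsum_le. intros k _.
      assert (Hq : 0 <= Cmod w ^ 2 / t ^ 2).
      { apply Rdiv_le_0_compat; [apply pow2_ge_0 | apply pow_lt, Ht]. }
      destruct (Nat.ltb_spec k 2) as [H|H].
      * replace (c k * w ^ k - c k * w ^ k)%C with (RtoC 0) by ring. rewrite Cmod_0.
        apply Rmult_le_pos; [exact Hq|].
        apply Rmult_le_pos; [apply Cmod_ge_0 | apply pow_le; lra].
      * replace (c k * w ^ k - 0)%C with (c k * w ^ k)%C by ring.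
        rewrite Cmod_mult, Cmod_pow. replace k with (2 + (k - 2))%nat at 2 4 by lia.
        rewrite !pow_add.
        replace (Cmod w ^ 2 / t ^ 2 * (Cmod (c k) * (t ^ 2 * t ^ (k - 2))))
          with (Cmod (c k) * (Cmod w ^ 2 * t ^ (k - 2))) by (field; lra).
        apply Rmult_le_compat_l; [apply Cmod_ge_0|].
        apply Rmult_le_compat_l; [apply pow2_ge_0|]. apply pow_incr. lra.
    + replace (Cmod w ^ 2 * (K / t ^ 2)) with (Cmod w ^ 2 / t ^ 2 * K) by (field; lra).
      apply Rmult_le_compat_l; [|apply HK].
      apply Rdiv_le_0_compat; [apply pow2_ge_0 | apply pow_lt, Ht].
Qed.

(** [C_derive] is the value of a limit, so the difference quotient is estimated directly: by the
    quadratic remainder it differs from [c 1] by at most [K |w|]. *)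
Lemma C_derive_Cpser (F : C -> C) (z : C) (c : nat -> C) (delta : R) :
  0 < delta -> (forall w, Cmod w < delta -> Cpser c w (F (z + w)%C)) ->
  C_derive F z = c 1%nat.
Proof.
  intros Hd Hc. set (t := delta / 2). assert (Ht : 0 < t) by (unfold t; lra).
  set (v := fun k => Cmod (c k) * t ^ k).
  assert (Hv0 : forall k, 0 <= v k).
  { intros k. apply Rmult_le_pos; [apply Cmod_ge_0 | apply pow_le; lra]. }
  assert (Hv : forall n, Rsum v n <= Series v).
  { intros n. apply Rsum_le_Series; [exact Hv0|].
    apply (Cpser_disk_ex_series c (fun w => F (z + w)%C) delta); [exact Hc | unfold t; lra]. }
  assert (HFz : F z = c 0%nat).
  { apply Cpser_at_0. rewrite <- (Cplus_0_r z). apply Hc. rewrite Cmod_0. exact Hd. }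
  apply is_C_lim_unique. apply filterlim_locally. intros eps.
  pose proof (cond_pos eps) as He.
  set (K := Series v / t ^ 2).
  assert (HK : 0 <= K).
  { apply Rdiv_le_0_compat; [exact (Rle_trans _ _ _ (Rle_refl 0) (Hv O)) | apply pow_lt, Ht]. }
  (* The final halving absorbs the factor [sqrt 2] between the balls of the uniform structure on [C]
     and [Cmod]; [K + 1] keeps the denominator positive. *)
  assert (Heta : 0 < Rmin t (eps / (K + 1)) / 2).
  { apply Rdiv_lt_0_compat; [|lra]. apply Rmin_glb_lt; [exact Ht|].
    apply Rdiv_lt_0_compat; lra. }
  exists (mkposreal _ Heta). change (UniformSpace.sort C_UniformSpace) with C. intros y Hy Hne.
  apply C_NormedModule_mixin_compat2 in Hy.
  change (Cmod (y - z) < sqrt 2 * (Rmin t (eps / (K + 1)) / 2)) in Hy.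
  assert (Hs2 : sqrt 2 <= 2).
  { rewrite <- (sqrt_square 2) at 2 by lra. apply sqrt_le_1; lra. }
  assert (Hy2 : Cmod (y - z) < Rmin t (eps / (K + 1))) by nra.
  pose proof (Rmin_l t (eps / (K + 1))) as Hm1.
  pose proof (Rmin_r t (eps / (K + 1))) as Hm2.
  set (w := (y - z)%C) in *.
  assert (Hw : w <> RtoC 0).
  { intros E. apply Hne. replace y with (w + z)%C by (unfold w; ring). rewrite E. ring. }
  assert (Hwp : 0 < Cmod w) by (apply Cmod_gt_0, Hw).
  apply C_NormedModule_mixin_compat1.
  change (Cmod ((F y - F z) / w - c 1%nat) < eps).
  pose proof (Cpser_quadratic_remainder c t (Series v) w (F (z + w)%C) Ht ltac:(lra)
    (Hc w ltac:(unfold t in *; lra)) Hv) as H. fold K in H.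
  replace (z + w)%C with y in H by (unfold w; ring).
  replace ((F y - F z) / w - c 1%nat)%C
    with ((F y - (c 0%nat + c 1%nat * w)) / w)%C by (rewrite HFz; field; exact Hw).
  rewrite Cmod_div by exact Hw.
  apply Rlt_div_l; [exact Hwp|]. eapply Rle_lt_trans; [exact H|].
  replace (Cmod w ^ 2 * K) with ((Cmod w * K) * Cmod w) by ring.
  apply Rmult_lt_compat_r; [exact Hwp|].
  assert (G : Cmod w * (K + 1) < eps).
  { apply Rlt_div_r; [lra|]. lra. }
  nra.
Qed.

Lemma C_derive_on_disk (b : nat -> C) (g : C -> C) (z : C) :
  (forall z, in_disk z -> Cpser b z (g z)) -> in_disk z ->
  C_derive g z = Cps (Dcoef 1 b) z.
Proof.
  intros Hb Hz. unfold in_disk in *.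
  apply (C_derive_Cpser g z (fun m => Cps (Dcoef m b) z) (1 - Cmod z)); [lra|].
  intros w Hw. apply (Cpser_recenter b g 1); [exact Hb | lra].
Qed.

Lemma Cpser_analytic_on_disk (b : nat -> C) (g : C -> C) :
  (forall z, in_disk z -> Cpser b z (g z)) -> analytic_on_disk g.
Proof.
  intros Hb z0 H0. unfold in_disk in *.
  exists (1 - Cmod z0), (fun m => Cps (Dcoef m b) z0). split; [lra|].
  intros z Hz. apply is_pseries_Cpser.
  replace (g z) with (g (z0 + (z - z0))%C) by (f_equal; ring).
  apply (Cpser_recenter b g 1); [exact Hb | lra].
Qed.

(** * Suprema over the disk, the upper bound and the domain of the operator *)

Lemma sup_on_disk_bounded (u : C -> R) (B : R) :
  (forall z, in_disk z -> u z <= B) ->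
  exists s, sup_on_disk u = Finite s /\ s <= B /\ forall z, in_disk z -> u z <= s.
Proof.
  intros H. unfold sup_on_disk. set (E := fun r => exists z, in_disk z /\ r = u z).
  destruct (Lub_Rbar_correct E) as [Hub Hlub].
  assert (H1 : Rbar_le (Lub_Rbar E) B).
  { apply Hlub. intros r (z & Hz & ->). apply H, Hz. }
  assert (H2 : forall z, in_disk z -> Rbar_le (u z) (Lub_Rbar E)).
  { intros z Hz. apply Hub. exists z. split; [exact Hz | reflexivity]. }
  (* The disk is nonempty, which rules out the supremum minus infinity. *)
  assert (H0 : in_disk (RtoC 0)) by (unfold in_disk; rewrite Cmod_0; lra).
  pose proof (H2 _ H0) as H3.
  destruct (Lub_Rbar E) as [s| |]; [|destruct H1 | destruct H3].
  exists s. repeat split; assumption.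
Qed.

Lemma le_sup_on_disk (u : C -> R) (z : C) : in_disk z -> Rbar_le (u z) (sup_on_disk u).
Proof.
  intros Hz. apply (proj1 (Lub_Rbar_correct _)). exists z. split; [exact Hz | reflexivity].
Qed.

Lemma Cmod_le_Hinfty_norm (f : C -> C) (M : R) (z : C) :
  Rbar_le (Hinfty_norm f) M -> in_disk z -> Cmod (f z) <= M.
Proof.
  intros H Hz.
  exact (Rbar_le_trans (Cmod (f z)) _ M (le_sup_on_disk (fun z => Cmod (f z)) z Hz) H).
Qed.

Lemma derivative_bound (b : nat -> C) (M : R) (z : C) :
  0 <= M -> (forall n, Cmod (b n) <= M / INR (S n)) -> in_disk z ->
  (1 - Cmod z ^ 2) * Cmod (Cps (Dcoef 1 b) z) <= 2 * M.
Proof.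
  intros HM Hb Hz. unfold in_disk in Hz. pose proof (Cmod_ge_0 z) as H0.
  assert (H : Cmod (Cps (Dcoef 1 b) z) <= M * / (1 - Cmod z)).
  { apply (CSeries_Cmod_le _ (fun k => M * Cmod z ^ k)).
    - intros k. rewrite Cmod_mult, Cmod_pow.
      apply Rmult_le_compat_r; [apply pow_le, H0|].
      unfold Dcoef. rewrite Cmod_mult, Cmod_INR, binom_1_r.
      assert (Hk : 0 < INR (k + 1)) by (apply lt_0_INR; lia).
      specialize (Hb (k + 1)%nat). rewrite S_INR in Hb.
      apply Rle_trans with (INR (k + 1) * (M / (INR (k + 1) + 1))).
      + apply Rmult_le_compat_l; lra.
      + replace (INR (k + 1) * (M / (INR (k + 1) + 1)))
          with (M - M / (INR (k + 1) + 1)) by (field; lra).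
        pose proof (Rdiv_le_0_compat M (INR (k + 1) + 1) HM ltac:(lra)). lra.
    - intros n. rewrite Rsum_mult_l. apply Rmult_le_compat_l; [exact HM|].
      apply Rsum_geom_le. lra. }
  apply Rle_trans with ((1 - Cmod z ^ 2) * (M * / (1 - Cmod z))).
  - apply Rmult_le_compat_l; [nra | exact H].
  - replace ((1 - Cmod z ^ 2) * (M * / (1 - Cmod z))) with ((1 + Cmod z) * M) by (field; lra).
    nra.
Qed.

(** With [M] arbitrary, this yields both the membership in the Bloch space of the image of any
    bounded [f] and, for [M = 1], the upper bound [3]. *)
Lemma Bloch_norm_hilbert_le (f g : C -> C) (M : R) :
  (forall z, in_disk z -> Cmod (f z) <= M) -> hilbert_image f g ->
  exists s, Bloch_norm g = Finite s /\ s <= 3 * M.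
Proof.
  intros HM (a & b & Ha & Hab & Hb).
  assert (H0 : in_disk (RtoC 0)) by (unfold in_disk; rewrite Cmod_0; lra).
  assert (HM0 : 0 <= M) by (eapply Rle_trans; [apply Cmod_ge_0 | apply (HM _ H0)]).
  assert (Hbn : forall n, Cmod (b n) <= M / INR (S n)).
  { intros n. apply (hilbert_coef_le a f M n); [| exact HM |].
    - intros z Hz. apply is_pseries_Cpser, Ha, Hz.
    - apply is_series_Cseries, Hab. }
  assert (Hb' : forall z, in_disk z -> Cpser b z (g z)).
  { intros z Hz. apply is_pseries_Cpser, Hb, Hz. }
  destruct (sup_on_disk_bounded (fun z => (1 - Cmod z ^ 2) * Cmod (C_derive g z)) (2 * M))
    as (s & Hs & Hs2 & _).
  { intros z Hz. rewrite (C_derive_on_disk b g z Hb' Hz). apply derivative_bound; assumption. }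
  exists (Cmod (g (RtoC 0)) + s). unfold Bloch_norm. rewrite Hs. split; [reflexivity|].
  rewrite (Cpser_at_0 b _ (Hb' _ H0)). specialize (Hbn O). simpl in Hbn. lra.
Qed.

Lemma hilbert_image_exists (f : C -> C) (M : R) :
  analytic_on_disk f -> (forall z, in_disk z -> Cmod (f z) <= M) ->
  exists g, hilbert_image f g /\ analytic_on_disk g.
Proof.
  intros Hf HM. destruct (taylor_on_disk f M Hf HM) as [a Ha].
  set (b := fun n => CSeries (fun k => a k / RtoC (INR (n + k + 1)))%C).
  assert (Hab : forall n, Cseries (fun k => a k / RtoC (INR (n + k + 1)))%C (b n)).
  { intros n. apply CSeries_correct. apply (hilbert_coef_abs_convergent a M).
    intros K. apply (taylor_coef_square_summable a f); assumption. }
  assert (Hb : forall z, in_disk z -> Cpser b z (Cps b z)).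
  { intros z Hz. apply Cps_correct. apply ex_series_pow_bound with 1 M.
    - split; [apply Cmod_ge_0 | exact Hz].
    - intros n. rewrite pow1, Rmult_1_r.
      eapply Rle_trans; [apply (hilbert_coef_le a f M n); [exact Ha | exact HM | apply Hab]|].
      assert (H0 : in_disk (RtoC 0)) by (unfold in_disk; rewrite Cmod_0; lra).
      assert (HM0 : 0 <= M) by (eapply Rle_trans; [apply Cmod_ge_0 | apply (HM _ H0)]).
      assert (Hn : 1 <= INR (S n)) by (rewrite S_INR; pose proof (pos_INR n); lra).
      apply Rle_div_l; [lra|]. nra. }
  exists (Cps b). split; [|apply (Cpser_analytic_on_disk b), Hb].
  exists a, b. repeat split.
  - intros z Hz. apply is_pseries_Cpser, Ha, Hz.
  - intros n. apply is_series_Cseries, Hab.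
  - intros z Hz. apply is_pseries_Cpser, Hb, Hz.
Qed.

(** AM-GM: [1/(j+2) <= e/2 + 1/(2 e (j+2)^2)]. *)
Lemma hilbert_one_derivative_lower (r e T : R) :
  0 < e -> 0 <= r < 1 ->
  is_series (fun j => INR (S j) / INR (S (S j)) * r ^ j) T ->
  (1 - e / 2) / (1 - r) - / e <= T.
Proof.
  intros He Hr HT. set (t := fun j => INR (S j) / INR (S (S j)) * r ^ j) in *.
  assert (Ht0 : forall j, 0 <= t j).
  { intros j. apply Rmult_le_pos; [|apply pow_le; lra].
    apply Rdiv_le_0_compat; [apply pos_INR | apply lt_0_INR; lia]. }
  (* The loss [/ e] is the AM-GM coefficient [/ (2 * e)] times the bound [2] for the sum of inverse
     squares; it does not depend on [r]. *)
  assert (Hstep : forall n, (1 - e / 2) * Rsum (fun j => r ^ j) n - / e <= T).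
  { intros n. rewrite <- (is_series_unique _ _ HT).
    eapply Rle_trans; [|apply (Rsum_le_Series t n Ht0); eexists; exact HT].
    apply Rle_trans with ((1 - e / 2) * Rsum (fun j => r ^ j) n -
       / (2 * e) * Rsum (fun k => / INR (S k) ^ 2) n).
    - assert (H : Rsum (fun k => / INR (S k) ^ 2) n <= 2).
      { destruct n as [|n]; [simpl; lra|].
        eapply Rle_trans; [apply Rsum_inv_square_le|].
        pose proof (Rinv_0_lt_compat (INR (S n)) ltac:(apply lt_0_INR; lia)). lra. }
      assert (H2 : 0 < / (2 * e)) by (apply Rinv_0_lt_compat; lra).
      replace (/ e) with (/ (2 * e) * 2) by (field; lra).
      pose proof (Rmult_le_compat_l _ _ _ (Rlt_le _ _ H2) H). lra.
    - induction n as [|n IH]; [simpl; lra|]. cbn [Rsum].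
      assert (G : (1 - e / 2) * r ^ n - / (2 * e) * / INR (S n) ^ 2 <= t n).
      { unfold t. rewrite (S_INR (S n)).
        assert (Hx : 0 < INR (S n)) by (apply lt_0_INR; lia).
        set (x := INR (S n)) in *.
        assert (Hp0 : 0 <= r ^ n) by (apply pow_le; lra).
        assert (Hp1 : r ^ n <= 1) by (rewrite <- (pow1 n); apply pow_incr; lra).
        replace (x / (x + 1)) with (1 - / (x + 1)) by (field; lra).
        set (y := / (x + 1)).
        assert (Hy : 0 < y) by (apply Rinv_0_lt_compat; lra).
        assert (Hxy : y <= / x) by (apply Rinv_le_contravar; lra).
        (* The square of [1/(n+2)] is relaxed to that of [1/(n+1)], the form that
           [Rsum_inv_square_le] sums. *)
        assert (Hxy2 : y ^ 2 <= / x ^ 2).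
        { rewrite <- pow_inv. apply pow_incr. lra. }
        assert (Hi : 0 < / (2 * e)) by (apply Rinv_0_lt_compat; lra).
        assert (Ham : y <= e / 2 + / (2 * e) * y ^ 2).
        { assert (E : e / 2 + / (2 * e) * y ^ 2 - y = / (2 * e) * (e - y) ^ 2) by (field; lra).
          pose proof (Rmult_le_pos _ _ (Rlt_le _ _ Hi) (pow2_ge_0 (e - y))). lra. }
        assert (B1 : y * r ^ n <= (e / 2 + / (2 * e) * y ^ 2) * r ^ n)
          by (apply Rmult_le_compat_r; assumption).
        assert (B2 : / (2 * e) * y ^ 2 * r ^ n <= / (2 * e) * y ^ 2 * 1).
        { apply Rmult_le_compat_l; [|exact Hp1].
          apply Rmult_le_pos; [lra | apply pow2_ge_0]. }
        assert (B3 : / (2 * e) * y ^ 2 <= / (2 * e) * / x ^ 2)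
          by (apply Rmult_le_compat_l; lra).
        lra. }
      lra. }
  apply (is_lim_seq_le (fun n => (1 - e / 2) * Rsum (fun j => r ^ j) n - / e) (fun _ => T)
    ((1 - e / 2) / (1 - r) - / e) T Hstep); [|apply is_lim_seq_const].
  apply is_lim_seq_minus'; [|apply is_lim_seq_const].
  assert (Hgeom : is_series (fun j => r ^ j) (/ (1 - r)))
    by (apply is_series_geom; rewrite Rabs_pos_eq; lra).
  apply is_lim_seq_scal_l with (lu := Finite (/ (1 - r))).
  rewrite <- (is_series_unique _ _ Hgeom).
  apply is_lim_seq_Rsum. eexists; exact Hgeom.
Qed.

(** * The extremal function [1] *)

Lemma constant_one_in_Hinfty :
  in_Hinfty (fun _ => RtoC 1) /\ Rbar_le (Hinfty_norm (fun _ => RtoC 1)) 1.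
Proof.
  destruct (sup_on_disk_bounded (fun _ => Cmod (RtoC 1)) 1) as (s & Hs & Hs1 & _).
  { intros z _. rewrite Cmod_1. lra. }
  unfold in_Hinfty, Hinfty_norm. rewrite Hs. repeat split; [|exact Hs1].
  apply (Cpser_analytic_on_disk (fun k => match k with O => RtoC 1 | S _ => RtoC 0 end)).
  intros z _. apply (Cpser_first (fun k => match k with O => RtoC 1 | S _ => RtoC 0 end)).
  reflexivity.
Qed.

(** [hilbert_image] allows any sequence [a] that represents the function; uniqueness of Taylor
    coefficients forces [1, 0, 0, ...], and only the term [k = 0] of each series survives. *)
Lemma hilbert_image_one_coef (g : C -> C) :
  hilbert_image (fun _ => RtoC 1) g ->
  forall z, in_disk z -> Cpser (fun n => RtoC (/ INR (S n))) z (g z).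
Proof.
  intros (a & b & Ha & Hab & Hb) z Hz.
  set (e0 := fun k => match k with O => RtoC 1 | S _ => RtoC 0 end).
  assert (Hae : forall k, a k = e0 k).
  { intros k. apply (Cpser_unique a e0 (fun _ => RtoC 1) 1); [lra | |].
    - intros y Hy. apply is_pseries_Cpser, Ha, Hy.
    - intros y _. apply (Cpser_first e0). reflexivity. }
  apply Cseries_ext with (fun k => b k * z ^ k)%C; [|apply is_pseries_Cpser, Hb, Hz].
  intros n. f_equal.
  apply Cseries_unique with (1 := proj1 (is_series_Cseries _ _) (Hab n)).
  assert (Hn : INR (S n) <> 0) by (apply not_0_INR; lia).
  replace (RtoC (/ INR (S n))) with (a O / RtoC (INR (n + 0 + 1)))%C.
  - apply (Cseries_first (fun k => a k / RtoC (INR (n + k + 1)))%C).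
    intros k. rewrite Hae. simpl e0. unfold Cdiv. ring.
  - rewrite Hae. replace (n + 0 + 1)%nat with (S n) by lia.
    rewrite RtoC_inv by exact Hn. simpl e0. unfold Cdiv. ring.
Qed.

Lemma Bloch_norm_hilbert_one (g : C -> C) :
  hilbert_image (fun _ => RtoC 1) g -> Rbar_le 3 (Bloch_norm g).
Proof.
  intros Hg. pose proof (hilbert_image_one_coef g Hg) as Hb.
  set (b := fun n => RtoC (/ INR (S n))) in Hb.
  assert (H0 : in_disk (RtoC 0)) by (unfold in_disk; rewrite Cmod_0; lra).
  assert (Hg0 : Cmod (g (RtoC 0)) = 1).
  { rewrite (Cpser_at_0 b _ (Hb _ H0)). unfold b. simpl. rewrite Rinv_1. apply Cmod_1. }
  unfold Bloch_norm. rewrite Hg0.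
  pose proof (fun z => le_sup_on_disk (fun z => (1 - Cmod z ^ 2) * Cmod (C_derive g z)) z) as Hsup.
  set (D := sup_on_disk _) in *.
  assert (Hlow : forall e, 0 < e < 1 -> Rbar_le ((2 - e ^ 2) * (1 - e / 2 - e)) D).
  { intros e He. set (r := 1 - e ^ 2).
    assert (Hr : 0 <= r < 1) by (unfold r; nra).
    assert (Hmod : Cmod (RtoC r) = r) by (rewrite Cmod_R, Rabs_pos_eq; lra).
    assert (Hd : in_disk (RtoC r)) by (unfold in_disk; lra).
    eapply Rbar_le_trans; [|apply (Hsup _ Hd)].
    change ((2 - e ^ 2) * (1 - e / 2 - e) <=
            (1 - Cmod (RtoC r) ^ 2) * Cmod (C_derive g (RtoC r))).
    rewrite Hmod, (C_derive_on_disk b g _ Hb Hd).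
    assert (Hser : Cpser (Dcoef 1 b) (RtoC r) (Cps (Dcoef 1 b) (RtoC r))).
    { apply Cps_correct. apply (Dcoef_ex_series 1 b 1); [|lra].
      intros t Ht. apply (Cpser_disk_ex_series b g 1 t Hb Ht). }
    apply Cseries_Re in Hser.
    assert (HT : (1 - e / 2) / (1 - r) - / e <= Re (Cps (Dcoef 1 b) (RtoC r))).
    { apply hilbert_one_derivative_lower; [lra | exact Hr |].
      apply is_series_ext with (2 := Hser). intros j.
      unfold Dcoef, b. rewrite binom_1_r, Nat.add_1_r, <- RtoC_pow, <- !RtoC_mult.
      reflexivity. }
    pose proof (Rle_trans _ _ _ (Rle_abs _) (re_le_Cmod (Cps (Dcoef 1 b) (RtoC r)))) as HR.
    replace ((2 - e ^ 2) * (1 - e / 2 - e))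
      with ((1 - r ^ 2) * ((1 - e / 2) / (1 - r) - / e))
      by (replace (1 - r) with (e ^ 2) by (unfold r; ring); unfold r; field; lra).
    apply Rmult_le_compat_l; [nra | lra]. }
  destruct D as [s| |]; simpl; [| exact I | destruct (Hlow (1 / 2)); lra].
  simpl in Hlow. apply Rnot_lt_le. intros Hs.
  (* If [s < 2], then [e = (2 - s) / 8] contradicts [Hlow], whose left side exceeds [2 - 8 * e = s];
     nonnegativity of [s] ensures [e < 1]. *)
  assert (Hpos : 0 <= s).
  { specialize (Hlow (1 / 2) ltac:(lra)). lra. }
  specialize (Hlow ((2 - s) / 8) ltac:(lra)). nra.
Qed.

Theorem theorem6p1 :
  (forall f : C -> C, in_Hinfty f ->
     exists g : C -> C, hilbert_image f g /\ in_Bloch g) /\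
  operator_norm in_Hinfty Hinfty_norm Bloch_norm hilbert_image = Finite 3.
Proof.
  split.
  - intros f [Hf Hfin].
    assert (HM : forall z, in_disk z -> Cmod (f z) <= real (Hinfty_norm f)).
    { intros z Hz. apply Cmod_le_Hinfty_norm; [|exact Hz].
      rewrite Hfin. apply Rbar_le_refl. }
    destruct (hilbert_image_exists f _ Hf HM) as (g & Hg & Hga).
    exists g. split; [exact Hg|]. split; [exact Hga|].
    destruct (Bloch_norm_hilbert_le f g _ HM Hg) as (s & Hs & _).
    rewrite Hs. reflexivity.
  - apply Rbar_is_lub_unique. split.
    + intros r (f & g & Hf & Hf1 & Hg & ->).
      destruct (Bloch_norm_hilbert_le f g 1) as (s & Hs & Hs3); [| exact Hg |].
      * intros z Hz. apply Cmod_le_Hinfty_norm; assumption.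
      * rewrite Hs. simpl. lra.
    + intros B HB. destruct constant_one_in_Hinfty as [H1 H2].
      destruct (hilbert_image_exists (fun _ => RtoC 1) 1 (proj1 H1)) as (g & Hg & _).
      { intros z Hz. rewrite Cmod_1. lra. }
      eapply Rbar_le_trans; [apply (Bloch_norm_hilbert_one g Hg)|].
      apply HB. exists (fun _ => RtoC 1), g. repeat split; (exact Hg || apply H1 || exact H2).
Qed.
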